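(* Let $H_1,H_2$ be separable Hilbert spaces with $\dim H_1=\infty$ and consider the linear model $Y_k=\Psi(X_k)+\varepsilon_k$, $k\ge1$, where Assumption (A) (stated in the context) holds and $H_1=\overline{\mathrm{Im}(C)}$, with $C=E[X_1\otimes X_1]$. Let $m_n\to\infty$ with $m_n=o(\sqrt n)$ and let $$K_n=\max\{j\ge1:\hat\lambda_1/\hat\lambda_j\le m_n\}.$$ Let $\hat\Psi_{K_n}(x)=\sum_{j=1}^{K_n}\frac{\hat\Delta(\hat v_j)}{\hat\lambda_j}\langle\hat v_j,x\rangle_{H_1}$. Then $\|\Psi(X_n)-\hat\Psi_{K_n}(X_n)\|_{H_2}\to0$ in probability as $n\to\infty$.
   Context: Notation: all random variables are defined on a common probability space. $\mathcal L(H_i,H_j)$ is the space of bounded linear operators from $H_i$ to $H_j$. For $x\in H_i$, $y\in H_j$, $x\otimes y:H_i\to H_j$ is $(x\otimes y)(v)=\langle x,v\rangle y$. $\nu_{p,H}(X):=(E\|X\|_H^p)^{1/p}$, and $X\in L^p_H$ means $\nu_{p,H}(X)<\infty$. For $X,Y$ with finite second moments, $X\perp Y$ means $E[X\otimes Y]=0$. $H$-white noise: a sequence of orthogonal elements of $L^2_H$ with constant mean and constant covariance operator. $L^p$–$m$–approximability: a random sequence $\{X_n\}_{n\ge1}$ with values in $H$ is $L^p$–$m$–approximable if it can be represented as $X_n=f(\delta_n,\delta_{n-1},\dots)$, where the $\delta_i$ are i.i.d. elements of a measurable space $S$ and $f:S^\infty\to H$ is measurable, and if, with $\delta_i'$ independent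 copies of the $\delta_i$ on the same probability space and $X_n^{(m)}=f(\delta_n,\dots,\delta_{n-m+1},\delta'_{n-m},\delta'_{n-m-1},\dots)$, one has $\sum_{m\ge1}\nu_{p,H}(X_m-X_m^{(m)})<\infty$. An $L^4$–$m$–approximable sequence is understood to have finite fourth moments. Assumption (A): $\Psi\in\mathcal L(H_1,H_2)$; $\{X_k\}$ (values in $H_1$) and $\{\varepsilon_k\}$ (values in $H_2$) are zero mean and $L^4$–$m$–approximable; $\{\varepsilon_k\}$ is $H_2$-white noise; $X_k\perp\varepsilon_k$ for every $k\ge1$. From the sample $(X_1,Y_1),\dots,(X_n,Y_n)$ put $\hat C=\frac1n\sum_{k=1}^nX_k\otimes X_k$ and $\hat\Delta=\frac1n\sum_{k=1}^nX_k\otimes Y_k$. $\hat\lambda_1\ge\hat\lambda_2\ge\cdots\ge0$ are the eigenvalues of $\hat C$ and $\hat v_j$ corresponding orthonormal eigenvectors. Conventions: $a/0=+\infty$ for every $a\ge0$, $\max\emptyset=0$, empty sums are $0$.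
   Formalization: The sequences X_k and ε_k are assumed L^4–m–approximable with one common family of innovations δ_i (and copies δ_i'); with unrelated innovations the claim fails, e.g. Ψ=0, ε_k=Z X_k, X_k i.i.d. symmetric and bounded, Z an independent random sign. *)

(* Defs.v *)
(* MathComp / MathComp-Analysis. *)
From HB Require Import structures.
From mathcomp Require Import all_boot all_order all_algebra.
From mathcomp Require Import all_classical all_reals all_analysis.

Set Implicit Arguments.
Unset Strict Implicit.
Unset Printing Implicit Defensive.

Import Order.TTheory GRing.Theory Num.Theory.
Import numFieldNormedType.Exports.

Local Open Scope classical_set_scope.
Local Open Scope ring_scope.

(* Real Hilbert spaces; completeness comes from CompleteNormedModule and
   positive definiteness of the inner product from [inner_norm]. *)
HB.mixin Record CompleteNormedModule_isHilbert (R : realType) V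
    & CompleteNormedModule R V := {
  inner : V -> V -> R ;
  innerC : forall x y, inner x y = inner y x ;
  inner_linearl : forall (a : R) (x y z : V),
    inner (a *: x + y) z = a * inner x z + inner y z ;
  inner_norm : forall x : V, inner x x = `|x| ^+ 2
}.

#[short(type="hilbertType")]
HB.structure Definition Hilbert (R : realType) :=
  {V of CompleteNormedModule R V & CompleteNormedModule_isHilbert R V}.

Definition separable (T : topologicalType) : Prop :=
  exists2 D : set T, countable D & dense D.

Definition infinite_dimensional (R : realType) (V : lmodType R) : Prop :=
  forall (n : nat) (b : 'I_n -> V),
    exists x : V, forall c : 'I_n -> R, x <> \sum_(i < n) c i *: b i.

Definition bounded_operator (R : realType) (V W : normedModType R)
    (A : V -> W) : Prop :=
  exists M : R, forall x : V, `|A x| <= M * `|x|.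

Definition tensor (R : realType) (H1 H2 : hilbertType R) (x : H1) (y : H2)
    : H1 -> H2 :=
  fun v => inner x v *: y.

(* [lam j] and [v j] are the (j+1)-st eigenvalue and eigenvector. The last
   clause says that no eigenvector for a nonzero eigenvalue is missed, that is,
   every nonzero eigenvalue is listed with its full multiplicity. When A has
   finite rank the list goes on with zeros, and the corresponding [v j] are
   orthonormal vectors of the kernel. *)
Definition eigensystem (R : realType) (H : hilbertType R) (A : H -> H)
    (lam : nat -> R) (v : nat -> H) : Prop :=
  [/\ (forall j, 0 <= lam j),
      (forall i j, (i <= j)%N -> lam j <= lam i),
      (forall i j, inner (v i) (v j) = (i == j)%:R),
      (forall j, A (v j) = lam j *: v j)
    & (forall (mu : R) (x : H), mu != 0 -> A x = mu *: x ->
        (forall j, inner (v j) x = 0) -> x = 0)].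

(* Division with the convention a / 0 = +oo, including a = 0. *)
Definition ediv (R : realType) (a b : R) : \bar R :=
  if b == 0 then +oo%E else (a / b)%:E.

(* The maximum of A, and 0 if A is empty (also if A is unbounded). *)
Definition nat_max (A : set nat) : nat :=
  xget 0%N [set k | A k /\ forall j, A j -> (j <= k)%N].

Definition borel (T : ptopologicalType) := g_sigma_algebraType (@open T).

Section sequence_space.
Context d (S : measurableType d).

Definition cylinders : set (set (nat -> S)) :=
  [set A | exists i (B : set S), measurable B /\ A = [set s | B (s i)]].

(* S^oo with the product sigma-algebra *)
Definition sequence_space := g_sigma_algebraType cylinders.

End sequence_space.

Section probability_notions.
Context (R : realType) d (Omega : measurableType d) (P : probability Omega R).

Definition mutually_independent (I : choiceType) d' (S : measurableType d')
    (Z : I -> Omega -> S) : Prop :=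
  forall (s : seq I) (A : I -> set S), uniq s ->
    (forall i, measurable (A i)) ->
    P (\bigcap_(i in [set` s]) (Z i @^-1` A i)) =
    (\prod_(i <- s) P (Z i @^-1` A i))%E.

Definition identically_distributed (I : Type) d' (S : measurableType d')
    (Z : I -> Omega -> S) : Prop :=
  forall (i j : I) (A : set S), measurable A ->
    P (Z i @^-1` A) = P (Z j @^-1` A).

Definition iid (I : choiceType) d' (S : measurableType d')
    (Z : I -> Omega -> S) : Prop :=
  [/\ (forall i, measurable_fun setT (Z i)),
      mutually_independent Z & identically_distributed Z].

(* nu_{p,H}(Z) *)
Definition nu (p : R) (H : normedModType R) (Z : Omega -> H) : \bar R :=
  (Lnorm P p%:E (fun w => `|Z w|%:E)).

(* e = E[Z], where Z is Bochner integrable (in a separable H: Borel with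
   integrable norm) and the integral is identified by testing against the
   inner product. *)
Definition is_expectation (H : hilbertType R) (Z : Omega -> H) (e : H)
    : Prop :=
  [/\ measurable_fun setT (Z : Omega -> borel H),
      ('E_P[(fun w => `|Z w|)%R] < +oo)%E
    & forall h : H, ('E_P[(fun w => inner (Z w) h)] = (inner e h)%:E)%E].

(* A = E[T] for a random operator T, evaluated vector by vector. *)
Definition is_operator_expectation (H1 H2 : hilbertType R)
    (T : Omega -> H1 -> H2) (A : H1 -> H2) : Prop :=
  forall v : H1, is_expectation (fun w => T w v) (A v).

Definition zero_mean (H : hilbertType R) (Z : nat -> Omega -> H) : Prop :=
  forall k, (0 < k)%N -> is_expectation (Z k) 0.

(* Z _|_ W *)
Definition perp (H1 H2 : hilbertType R) (Z : Omega -> H1) (W : Omega -> H2)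
    : Prop :=
  is_operator_expectation (fun w => tensor (Z w) (W w)) (fun=> 0).

Definition white_noise (H : hilbertType R) (Z : nat -> Omega -> H) : Prop :=
  [/\ (forall k, (0 < k)%N -> (nu 2 (Z k) < +oo)%E),
      (forall k l, (0 < k)%N -> (0 < l)%N -> k != l -> perp (Z k) (Z l))
    & exists (mu : H) (Q : H -> H), forall k, (0 < k)%N ->
        is_expectation (Z k) mu /\
        is_operator_expectation
          (fun w => tensor (Z k w - mu) (Z k w - mu)) Q].

(* delta is i.i.d. and delta' is an independent copy of it: all the variables
   delta_i, delta'_j together are i.i.d. *)
Definition innovations d' (S : measurableType d')
    (delta delta' : int -> Omega -> S) : Prop :=
  iid (fun i : int + int =>
         match i with inl k => delta k | inr k => delta' k end).

(* (delta_n, delta_{n-1}, ...) *)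
Definition past (S : Type) (delta : int -> Omega -> S) (n : nat) (w : Omega)
    : nat -> S :=
  fun i => delta (n%:Z - i%:Z) w.

(* (delta_n, ..., delta_{n-m+1}, delta'_{n-m}, delta'_{n-m-1}, ...) *)
Definition coupled_past (S : Type) (delta delta' : int -> Omega -> S)
    (m n : nat) (w : Omega) : nat -> S :=
  fun i => if (i < m)%N then delta (n%:Z - i%:Z) w else delta' (n%:Z - i%:Z) w.

(* Z_n = f (delta_n, delta_{n-1}, ...), n >= 1, is an L^p-m-approximable
   representation of Z. *)
Definition Lp_m_approximable_by (p : R) (H : hilbertType R) d'
    (S : measurableType d') (delta delta' : int -> Omega -> S)
    (f : (nat -> S) -> H) (Z : nat -> Omega -> H) : Prop :=
  [/\ measurable_fun setT (f : sequence_space S -> borel H),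
      (forall n w, (0 < n)%N -> Z n w = f (past delta n w)),
      (forall n, (0 < n)%N -> (nu p (Z n) < +oo)%E)
    & (\sum_(1 <= m <oo)
        nu p (fun w => (Z m w - f (coupled_past delta delta' m m w))%R)
       < +oo)%E].

(* Both sequences are L^p-m-approximable, with the same innovations delta_i.
   With unrelated innovations, X and eps may have a joint law that is not even
   ergodic: if the X_k are i.i.d. and symmetric and Z is an independent random
   sign, then X and eps_k = Z X_k are each i.i.d. with X_k _|_ eps_k for
   all k, yet the covariances of X_k and eps_k do not average out. *)
Definition Lp_m_approximable2 (p : R) (H1 H2 : hilbertType R)
    (X : nat -> Omega -> H1) (eps : nat -> Omega -> H2) : Prop :=
  exists (d' : measure_display) (S : measurableType d')
         (delta delta' : int -> Omega -> S)
         (f : (nat -> S) -> H1) (g : (nat -> S) -> H2),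
    [/\ innovations delta delta',
        Lp_m_approximable_by p delta delta' f X
      & Lp_m_approximable_by p delta delta' g eps].

Record assumption_A (H1 H2 : hilbertType R) (Psi : {linear H1 -> H2})
    (X : nat -> Omega -> H1) (eps : nat -> Omega -> H2) : Prop := {
  A_bounded : bounded_operator Psi ;
  A_mean_X : zero_mean X ;
  A_mean_eps : zero_mean eps ;
  A_approximable : Lp_m_approximable2 4 X eps ;
  A_white_noise : white_noise eps ;
  A_perp : forall k, (0 < k)%N -> perp (X k) (eps k) }.

Definition cvg_in_probability (Z : nat -> Omega -> R) (l : Omega -> R)
    : Prop :=
  forall e : R, 0 < e -> P [set w | e < `|Z n w - l w|] @[n --> \oo] --> 0%E.

End probability_notions.

(* (1/n) sum_{k=1}^n X_k (x) Y_k *)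
Definition empirical_tensor (R : realType) (T : Type) (H1 H2 : hilbertType R)
    (X : nat -> T -> H1) (Y : nat -> T -> H2) (n : nat) (w : T) : H1 -> H2 :=
  fun v => n%:R^-1 *: \sum_(1 <= k < n.+1) tensor (X k w) (Y k w) v.

(* K = max {j >= 1 : lam_1 / lam_j <= m}; [lam] is indexed from 0. *)
Definition truncation_level (R : realType) (lam : nat -> R) (m : R) : nat :=
  nat_max [set j | (0 < j)%N /\ (ediv (lam 0%N) (lam j.-1) <= m%:E)%E].

Definition truncated_estimator (R : realType) (H1 H2 : hilbertType R)
    (Delta : H1 -> H2) (lam : nat -> R) (v : nat -> H1) (K : nat)
    : H1 -> H2 :=
  fun x => \sum_(j < K) inner (v j) x *: ((lam j)^-1 *: Delta (v j)).

(* Main.v *)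
(* Write Delta_hat = Psi C_hat + E_hat, where E_hat is the empirical covariance
   of X and eps, and let P be the projection onto the first K_n empirical
   eigenvectors. The prediction error is Psi (X_n - P X_n) - E_hat C_hat^+ X_n,
   where C_hat^+ is the inverse of C_hat truncated at level K_n.

   Noise term: |C_hat^+| <= m_n / lambda_hat_1 and E |E_hat|_HS^2 = O(1/n),
   while lambda_hat_1 is bounded away from 0 and |X_n| is bounded in
   probability; hence m_n = o(sqrt n) suffices.

   Bias term: no gap between eigenvalues is used. As the law of X_n does not
   depend on n, X_n is close to one of finitely many vectors u, and u is close
   to some C z since the range of C is dense. Finally
   |(1 - P) C z| <= |(C - C_hat) z| + |(1 - P) C_hat z|, where
   |(1 - P) C_hat z| <= lambda_hat_1 / m_n * |z|.

   Both covariance estimates compare (X_l, eps_l) with its coupled version that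
   is independent of (X_k, eps_k), at a cost summable in l - k. *)
Require Import Defs.
From HB Require Import structures.
From mathcomp Require Import all_boot all_order all_algebra.
From mathcomp Require Import all_classical all_reals all_analysis.
From mathcomp Require Import measurable_realfun ring lra zify.
From mathcomp Require complex.

Set Implicit Arguments.
Unset Strict Implicit.
Unset Printing Implicit Defensive.

Import Order.TTheory GRing.Theory Num.Theory.
Import numFieldNormedType.Exports.

Local Open Scope classical_set_scope.
Local Open Scope ring_scope.

(** * Inner products and orthonormal systems *)

(** Two obstacles lie outside the error estimate itself. Convergence in probability evaluates [P] on
    an event built from arbitrarily chosen eigenvectors, and bounds on other events say nothing
    about it unless it is measurable; the polynomial calculus serves only to prove this
    measurability. Moreover $X_n$ depends on $\hat C$ and $\hat E$. Conditioning is avoided: the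
    error is bounded pointwise by products of scalars, and each scalar is controlled on an event of
    its own. Both covariance estimates reduce to one double sum over $k,l$ of $\langle
    a_k,a_l\rangle\langle b_k,b_l\rangle$. For $\|\hat E\|_{HS}^2$ the pair $(a,b)$ is
    $(X,\varepsilon)$; for $\|\hat Cz\|^2$ it is $(X,\langle X,z\rangle z)$. They differ only in the
    mean of the kernel under independence: it is 0 in the first case, and in the second it is the
    term that cancels against $\|Cz\|^2$. *)

Section inner_product.
Context (R : realType) (H : hilbertType R).
Implicit Types (a : R) (x y z : H).

Lemma innerDl x y z : inner (x + y) z = inner x z + inner y z.
Proof. by have := inner_linearl 1 x y z; rewrite scale1r mul1r. Qed.

Lemma inner0l z : inner 0 z = 0 :> R.
Proof. by apply: (addrI (inner 0 z)); rewrite -innerDl !addr0. Qed.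

Lemma innerZl a x z : inner (a *: x) z = a * inner x z.
Proof. by have := inner_linearl a x 0 z; rewrite addr0 inner0l addr0. Qed.

Lemma innerNl x z : inner (- x) z = - inner x z.
Proof. by rewrite -scaleN1r innerZl mulN1r. Qed.

Lemma innerBl x y z : inner (x - y) z = inner x z - inner y z.
Proof. by rewrite innerDl innerNl. Qed.

Lemma innerDr x y z : inner x (y + z) = inner x y + inner x z.
Proof. by rewrite innerC innerDl !(innerC _ x). Qed.

Lemma inner0r z : inner z 0 = 0 :> R.
Proof. by rewrite innerC inner0l. Qed.

Lemma innerZr a x z : inner x (a *: z) = a * inner x z.
Proof. by rewrite innerC innerZl innerC. Qed.

Lemma innerNr x z : inner x (- z) = - inner x z.
Proof. by rewrite innerC innerNl innerC. Qed.

Lemma innerBr x y z : inner x (y - z) = inner x y - inner x z.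
Proof. by rewrite innerDr innerNr. Qed.

Lemma inner_suml (I : Type) (r : seq I) (F : I -> H) z :
  inner (\sum_(i <- r) F i) z = \sum_(i <- r) inner (F i) z.
Proof.
by elim/big_rec2: _ => [|i _ y _ <-]; rewrite ?inner0l// innerDl.
Qed.

Lemma inner_sumr (I : Type) (r : seq I) (F : I -> H) z :
  inner z (\sum_(i <- r) F i) = \sum_(i <- r) inner z (F i).
Proof.
by rewrite innerC inner_suml; apply: eq_bigr => i _; rewrite innerC.
Qed.

Lemma sqr_normD x y : `|x + y| ^+ 2 = `|x| ^+ 2 + 2 * inner x y + `|y| ^+ 2.
Proof. by rewrite -!inner_norm innerDl !innerDr (innerC y x); ring. Qed.

Lemma sqr_normB x y : `|x - y| ^+ 2 = `|x| ^+ 2 - 2 * inner x y + `|y| ^+ 2.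
Proof. by rewrite sqr_normD normrN innerNr; ring. Qed.

Lemma inner_polarization x y :
  inner x y = (`|x + y| ^+ 2 - `|x - y| ^+ 2) / 4.
Proof. by rewrite sqr_normD sqr_normB; field. Qed.

Lemma cauchy_schwarz x y : `|inner x y| <= `|x| * `|y|.
Proof.
have [->|y0] := eqVneq y 0; first by rewrite inner0r !normr0 mulr0.
rewrite -(@ler_pXn2r _ 2)// ?nnegrE ?mulr_ge0// real_normK ?num_real//.
have ny : 0 < `|y| ^+ 2 by rewrite exprn_gt0// normr_gt0.
have := sqr_ge0 `|x - (inner x y / `|y| ^+ 2) *: y|.
rewrite sqr_normB innerZr normrZ exprMn real_normK ?num_real//.
set a := inner x y => h.
rewrite exprMn -subr_ge0; have -> : `|x| ^+ 2 * `|y| ^+ 2 - a ^+ 2 =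
  `|y| ^+ 2 * (`|x| ^+ 2 - 2 * (a / `|y| ^+ 2 * a)
     + (a / `|y| ^+ 2) ^+ 2 * `|y| ^+ 2).
  by field; rewrite normr_eq0.
by apply: mulr_ge0; [exact: ltW|exact: h].
Qed.

Lemma inner_le x y : inner x y <= `|x| * `|y|.
Proof. exact: le_trans (ler_norm _) (cauchy_schwarz x y). Qed.

Lemma eq_innerl x y : (forall z, inner x z = inner y z) -> x = y.
Proof.
move=> xy; apply/eqP; rewrite -subr_eq0 -normr_eq0 -sqrf_eq0 -inner_norm.
by rewrite innerBl xy subrr.
Qed.

End inner_product.

Section orthonormal_systems.
Context (R : realType) (H : hilbertType R) (v : nat -> H).
Hypothesis v_on : forall i j, inner (v i) (v j) = (i == j)%:R.

Lemma inner_sum_orthonormal (n : nat) (c : nat -> R) (j : nat) :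
  inner (\sum_(i < n) c i *: v i) (v j) = if (j < n)%N then c j else 0.
Proof.
rewrite inner_suml.
under eq_bigr do rewrite innerZl v_on.
case: ifP => jn.
  rewrite (bigD1 (Ordinal jn))//= eqxx mulr1 big1 ?addr0// => i.
  by rewrite -val_eqE/= => /negbTE->; rewrite mulr0.
rewrite big1// => i _; case: eqP => [ij|]; rewrite ?mulr0//.
by rewrite -ij ltn_ord in jn.
Qed.

Lemma sqr_norm_sum_orthonormal (n : nat) (c : nat -> R) :
  `|\sum_(i < n) c i *: v i| ^+ 2 = \sum_(i < n) c i ^+ 2.
Proof.
rewrite -inner_norm inner_sumr; apply: eq_bigr => i _.
by rewrite innerZr inner_sum_orthonormal ltn_ord expr2.
Qed.

Definition proj_on (n : nat) (x : H) : H := \sum_(i < n) inner (v i) x *: v i.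

Lemma inner_proj_on n x j :
  inner (proj_on n x) (v j) = if (j < n)%N then inner (v j) x else 0.
Proof. exact: (inner_sum_orthonormal _ (fun i => inner (v i) x)). Qed.

Lemma sqr_norm_proj_on n x :
  `|proj_on n x| ^+ 2 = \sum_(i < n) inner (v i) x ^+ 2.
Proof. exact: (sqr_norm_sum_orthonormal _ (fun i => inner (v i) x)). Qed.

Lemma inner_proj_on_self n x : inner (proj_on n x) x = `|proj_on n x| ^+ 2.
Proof.
rewrite sqr_norm_proj_on inner_suml; apply: eq_bigr => i _.
by rewrite innerZl expr2.
Qed.

Lemma pythagoras_proj_on n x :
  `|x| ^+ 2 = `|proj_on n x| ^+ 2 + `|x - proj_on n x| ^+ 2.
Proof. by rewrite sqr_normB innerC inner_proj_on_self; ring. Qed.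

Lemma proj_on_contract n x : `|x - proj_on n x| <= `|x|.
Proof.
rewrite -(@ler_pXn2r _ 2)// ?nnegrE//.
by rewrite [leRHS](pythagoras_proj_on n) lerDr sqr_ge0.
Qed.

Lemma bessel n x : \sum_(i < n) inner (v i) x ^+ 2 <= `|x| ^+ 2.
Proof.
by rewrite -sqr_norm_proj_on [leRHS](pythagoras_proj_on n) lerDl sqr_ge0.
Qed.

Lemma proj_onB n x y : proj_on n (x - y) = proj_on n x - proj_on n y.
Proof.
rewrite /proj_on -sumrB; apply: eq_bigr => i _.
by rewrite innerBr scalerBl.
Qed.

End orthonormal_systems.

Section symmetric_eigenvector.
Import complex.

(** The spectral theorem is applied over [R[i]], where [G] becomes hermitian. Since [G] is nonzero,
    so is some entry of its spectral diagonal, and that entry is real. A row of the unitary factor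
    is an eigenvector, and being an eigenvalue descends to the base field, which gives a real
    eigenvector. *)
Lemma symmetric_eigenvector (R : realType) (n : nat) (G : 'M[R]_n) :
  G^T = G -> G != 0 ->
  exists (mu : R) (u : 'rV[R]_n), [/\ mu != 0, u *m G = mu *: u & u != 0].
Proof.
move=> Gsym G0.
have n0 : (0 < n)%N.
  by case: n G Gsym G0 => // G _; rewrite (flatmx0 G) eqxx.
pose A : 'M[R[i]]_n := map_mx (real_complex R) G.
have Aherm : A \is hermsymmx.
  apply: realsym_hermsym.
    by apply/is_hermitianmxP;
      rewrite expr0 scale1r map_mx_id // /A map_trmx Gsym.
  by apply/mxOverP => i j; rewrite mxE; apply/complex_realP; exists (G i j).
have := orthomx_spectralP (hermitian_normalmx Aherm).
have Dreal := hermitian_spectral_diag_real Aherm.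
set Q := spectralmx A; set D := spectral_diag A => AE.
have [D0|] := eqVneq D 0.
  exfalso; move: AE; rewrite D0 linear0 mulmx0 mul0mx => A0.
  case/eqP: G0; apply/matrixP => i j; move/matrixP/(_ i j): A0.
  by rewrite !mxE => -[].
case/rV0Pn => j Dj.
have [mu muE] : exists mu, D 0 j = mu%:C%C.
  by apply/complex_realP; move/mxOverP: Dreal; exact.
have mu0 : mu != 0 by apply: contraNneq Dj => mu0; rewrite muE mu0.
have : eigenvalue A (real_complex R mu).
  apply/eigenvalueP; exists (row j Q).
    rewrite [in LHS]AE !mulmxA -row_mul mulmxV ?spectral_unit//.
    apply/rowP => k; rewrite -!row_mul mul1mx mul_diag_mx !mxE muE//.
  apply/eqP => Qj0.
  have := spectral_unit A; rewrite -row_free_unit -/Q => Qfree.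
  have := mulmx_free_eq0 (delta_mx 0 j : 'rV_n) Qfree.
  rewrite -rowE Qj0 eqxx => /esym/eqP/rowP/(_ j).
  by rewrite !mxE !eqxx => /eqP; rewrite oner_eq0.
rewrite eigenvalue_map.
by move=> /eigenvalueP[u uG u0]; exists mu, u.
Qed.

End symmetric_eigenvector.

(** * Spectrum of the empirical covariance operator *)

Section empirical_tensor_theory.
Context (R : realType) (T : Type) (H1 H2 : hilbertType R).
Variables (X : nat -> T -> H1) (Y : nat -> T -> H2) (n : nat) (w : T).
Local Notation Delta := (empirical_tensor X Y n w).

Lemma empirical_tensorE u :
  Delta u = n%:R^-1 *: \sum_(1 <= k < n.+1) inner (X k w) u *: Y k w.
Proof. by []. Qed.

Lemma empirical_tensorZ a u : Delta (a *: u) = a *: Delta u.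
Proof.
rewrite !empirical_tensorE scalerA mulrC -scalerA; congr (_ *: _).
by rewrite scaler_sumr; apply: eq_bigr => k _; rewrite innerZr scalerA.
Qed.

Lemma empirical_tensorD u1 u2 : Delta (u1 + u2) = Delta u1 + Delta u2.
Proof.
rewrite !empirical_tensorE -scalerDr -big_split; congr (_ *: _).
by apply: eq_bigr => k _; rewrite innerDr scalerDl.
Qed.

Lemma empirical_tensor_sum (I : Type) (r : seq I) (c : I -> R) (u : I -> H1) :
  Delta (\sum_(i <- r) c i *: u i) = \sum_(i <- r) c i *: Delta (u i).
Proof.
elim/big_rec2: _ => [|i y1 y2 _ <-].
  by rewrite -[0](scale0r 0) empirical_tensorZ !scale0r.
by rewrite empirical_tensorD empirical_tensorZ.
Qed.

Lemma inner_empirical_tensor u h : inner (Delta u) h =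
  n%:R^-1 * \sum_(1 <= k < n.+1) inner (X k w) u * inner (Y k w) h.
Proof.
rewrite innerZl inner_suml; congr (_ * _).
by apply: eq_bigr => k _; rewrite innerZl.
Qed.

End empirical_tensor_theory.

Section empirical_spectrum.
Context (R : realType) (T : Type) (H : hilbertType R).
Variables (X : nat -> T -> H) (n : nat) (w : T) (lam : nat -> R) (v : nat -> H).
Local Notation Chat := (empirical_tensor X X n w).
Hypothesis eigChat : eigensystem Chat lam v.

Let lam0 : forall j, 0 <= lam j. Proof. by case: eigChat. Qed.
Let lamS : forall i j, (i <= j)%N -> lam j <= lam i.
Proof. by case: eigChat. Qed.
Let v_on : forall i j, inner (v i) (v j) = (i == j)%:R.
Proof. by case: eigChat. Qed.
Let Cv : forall j, Chat (v j) = lam j *: v j. Proof. by case: eigChat. Qed.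

Lemma empirical_tensor_sym u h : inner (Chat u) h = inner u (Chat h).
Proof.
rewrite (innerC u) !inner_empirical_tensor; congr (_ * _).
by apply: eq_bigr => k _; rewrite mulrC.
Qed.

Lemma inner_empirical_tensor_eigenvector u j :
  inner (Chat u) (v j) = lam j * inner (v j) u.
Proof. by rewrite empirical_tensor_sym Cv innerZr innerC. Qed.

(** A rank count: otherwise [lam 0], ..., [lam n] are all positive, and the matrix [M] of scores,
    which has only [n] columns, satisfies [M M^T = n diag(lam)] of rank [n + 1]. *)
Lemma eigenvalue_eq0 j : (n <= j)%N -> lam j = 0.
Proof.
move=> nj; apply/eqP/negP => /negP lamj.
have lampos : forall i, (i <= n)%N -> 0 < lam i.
  move=> i ni; rewrite lt_neqAle lam0 andbT eq_sym.
  apply: contra_neq lamj => li; apply/eqP; rewrite eq_le lam0 andbT -li.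
  exact/lamS/(leq_trans ni).
pose M : 'M[R]_(n.+1, n) := \matrix_(i, k) inner (X k.+1 w) (v i).
have MM : M *m M^T = n%:R *: diag_mx (\row_i lam i).
  apply/matrixP => i k; rewrite !mxE.
  have := inner_empirical_tensor_eigenvector (v i) k.
  have [n0|n0] := eqVneq n 0%N.
    move=> _; have -> : n%:R = 0 :> R by rewrite n0.
    rewrite mul0r big1// => l _; have := ltn_ord l.
    by rewrite [X in (_ < X)%N]n0.
  rewrite inner_empirical_tensor v_on big_add1 big_mkord/=.
  move/(congr1 (fun z => n%:R * z)); rewrite mulVKf ?pnatr_eq0// => E.
  under eq_bigr do rewrite !mxE.
  rewrite E.
  rewrite [(k : nat) == i]eq_sym val_eqE mulr_natr.
  by case: eqVneq => // ->.
have Mfull : \rank (M *m M^T) = n.+1.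
  (* For [n = 0] the factor [n%:R^-1] is 0, so [Chat] vanishes, which contradicts [lam 0 > 0]
     directly. *)
  have [n0|n0] := posnP n.
    have := lampos 0%N isT; have := Cv 0%N.
    rewrite empirical_tensorE (_ : n%:R = 0 :> R) ?n0// invr0 scale0r =>
      /esym/eqP.
    rewrite scaler_eq0 => /orP[/eqP->|/eqP v0]; first by rewrite ltxx.
    by have := v_on 0 0; rewrite v0 inner0l eqxx => /esym/eqP; rewrite oner_eq0.
  apply/eqP; rewrite -[_ == _]/(row_free _) row_free_unit unitmxE unitfE.
  rewrite MM detZ mulf_neq0 ?expf_neq0 ?pnatr_eq0 -?lt0n//.
  rewrite det_diag; apply/prodf_neq0 => i _; rewrite mxE gt_eqF// lampos//.
  by rewrite -ltnS.
have := mxrankM_maxl M M^T; rewrite Mfull => /leq_trans/(_ (rank_leq_col M)).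
by rewrite ltnn.
Qed.

(* Otherwise the residuals [Z k] have a nonzero Gram matrix, one of whose
   eigenvectors yields an eigenvector of [Chat] orthogonal to all [v j]. *)
Lemma sample_in_eigenspan k : (0 < k <= n)%N -> X k w = proj_on v n (X k w).
Proof.
move=> kn; have n0 : (0 < n)%N by case/andP: kn => /leq_trans; exact.
pose Z k := X k w - proj_on v n (X k w).
have Zv i j : (j < n)%N -> inner (Z i) (v j) = 0.
  by move=> jn; rewrite innerBl (inner_proj_on v_on) jn innerC subrr.
apply/eqP; rewrite -subr_eq0 -/(Z k); apply: contraT => Zk.
pose G : 'M[R]_n := \matrix_(i, j) inner (Z i.+1) (Z j.+1).
have Gsym : G^T = G by apply/matrixP => i j; rewrite !mxE innerC.
have G0 : G != 0.
  have kn' : (k.-1 < n)%N by case: k kn {Zk}.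
  apply: contra_neq Zk => /matrixP/(_ (Ordinal kn') (Ordinal kn')).
  rewrite !mxE/= prednK; last by case/andP: kn.
  by move=> /eqP; rewrite inner_norm sqrf_eq0 normr_eq0 => /eqP.
have [mu [u [mu0 uG u0]]] := symmetric_eigenvector Gsym G0.
pose x := \sum_(i < n) u 0 i *: Z i.+1.
have Zx (j : 'I_n) : inner (Z j.+1) x = mu * u 0 j.
  rewrite inner_sumr; move/rowP/(_ j): uG; rewrite !mxE => <-.
  by apply: eq_bigr => i _; rewrite innerZr !mxE innerC.
have xv j : (j < n)%N -> inner x (v j) = 0.
  by move=> jn; rewrite inner_suml big1// => i _; rewrite innerZl Zv// mulr0.
have pxe y : inner (proj_on v n y) x = 0.
  by rewrite inner_suml big1// => i _; rewrite innerZl (innerC _ x) xv// mulr0.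
have Xx i : inner (X i w) x = inner (Z i) x by rewrite innerBl pxe subr0.
have Cx : Chat x = (n%:R^-1 * mu) *: x.
  have -> : Chat x = Chat x - proj_on v n (Chat x).
    rewrite [proj_on _ _ _]big1 ?subr0// => i _.
    rewrite innerC inner_empirical_tensor_eigenvector innerC xv//.
    by rewrite mulr0 scale0r.
  have projZ a y : proj_on v n (a *: y) = a *: proj_on v n y.
    rewrite scaler_sumr; apply: eq_bigr => i _.
    by rewrite innerZr scalerA.
  have projS : proj_on v n (\sum_(1 <= i < n.+1) inner (X i w) x *: X i w) =
      \sum_(1 <= i < n.+1) inner (X i w) x *: proj_on v n (X i w).
    rewrite {1}/proj_on.
    under eq_bigr do rewrite inner_sumr scaler_suml.
    rewrite exchange_big; apply: eq_bigr => i _/=; rewrite scaler_sumr.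
    by apply: eq_bigr => j _; rewrite innerZr scalerA.
  rewrite empirical_tensorE projZ projS -scalerBr -sumrB -scalerA;
    congr (_ *: _).
  rewrite big_add1 big_mkord/= scaler_sumr; apply: eq_bigr => i _.
  by rewrite -scalerBr -/(Z i.+1) Xx Zx scalerA.
have x0 : x = 0.
  have nmu : n%:R^-1 * mu != 0 by rewrite mulf_neq0// invr_neq0//
    pnatr_eq0 -lt0n.
  case: eigChat => _ _ _ _; apply; first exact: nmu.
    exact: Cx.
  (* From index [n] on orthogonality is not built into [x]. There [lam j = 0], while [x] belongs to
     a nonzero eigenvalue, and eigenvectors of the symmetric [Chat] for distinct eigenvalues are
     orthogonal. *)
  move=> j; have [/eigenvalue_eq0 lj|jn] := leqP n j; last by rewrite innerC xv.
  have := inner_empirical_tensor_eigenvector x j.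
  rewrite Cx innerZl lj mul0r innerC => /eqP.
  by rewrite mulf_eq0 (negbTE nmu)/= => /eqP.
exfalso; case/eqP: u0; apply/rowP => j; rewrite mxE.
by have := Zx j; rewrite x0 inner0r => /esym/eqP;
  rewrite mulf_eq0 (negbTE mu0) => /eqP.
Qed.

Lemma sum_inner_eigenvectors k y : (0 < k <= n)%N ->
  inner (X k w) y = \sum_(j < n) inner (v j) (X k w) * inner (v j) y.
Proof.
move=> kn; rewrite {1}(sample_in_eigenspan kn) inner_suml.
by apply: eq_bigr => j _; rewrite innerZl.
Qed.

Lemma spectral_decomposition u :
  Chat u = \sum_(j < n) (lam j * inner (v j) u) *: v j.
Proof.
rewrite empirical_tensorE big_nat.
under eq_bigr => k kn do rewrite (sample_in_eigenspan kn) scaler_sumr.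
rewrite -big_nat exchange_big scaler_sumr/=; apply: eq_bigr => j _.
rewrite -inner_empirical_tensor_eigenvector inner_empirical_tensor -scalerA.
rewrite scaler_suml; congr (_ *: _); rewrite !big_nat; apply: eq_bigr => k kn.
by rewrite scalerA (innerC (v j)) -(sample_in_eigenspan kn).
Qed.

Lemma inner_spectral_decomposition u h : inner (Chat u) h =
  \sum_(j < n) lam j * inner (v j) u * inner (v j) h.
Proof.
rewrite spectral_decomposition inner_suml; apply: eq_bigr => j _.
by rewrite innerZl.
Qed.

Lemma rayleigh_le u : inner (Chat u) u <= lam 0 * `|u| ^+ 2.
Proof.
rewrite inner_spectral_decomposition.
apply: (@le_trans _ _ (lam 0 * \sum_(j < n) inner (v j) u ^+ 2)).
  rewrite mulr_sumr; apply: ler_sum => j _; rewrite -mulrA -expr2.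
  by rewrite ler_wpM2r ?sqr_ge0// lamS.
by rewrite ler_wpM2l// bessel.
Qed.

Lemma top_eigenvalueE : lam 0 = inner (Chat (v 0)) (v 0).
Proof. by rewrite Cv innerZl v_on eqxx mulr1. Qed.

Lemma top_eigenvalue_le_trace :
  lam 0 <= n%:R^-1 * \sum_(1 <= k < n.+1) `|X k w| ^+ 2.
Proof.
rewrite top_eigenvalueE inner_empirical_tensor ler_wpM2l ?invr_ge0//.
apply: ler_sum => k _; rewrite -expr2 -[leLHS]real_normK ?num_real//.
rewrite lerXn2r ?nnegrE// (le_trans (cauchy_schwarz _ _))//.
have -> : `|v 0| = 1; last by rewrite mulr1.
by apply/eqP; rewrite -(@eqrXn2 _ 2)// expr1n -inner_norm v_on eqxx.
Qed.

End empirical_spectrum.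

(** * Deterministic bound on the prediction error *)

(** Lagrange's identity: the difference of the two sides is half the double sum of
    [(a i * b j - a j * b i) ^+ 2]. *)
Lemma cauchy_schwarz_sum (R : realType) (n : nat) (a b : 'I_n -> R) :
  (\sum_i a i * b i) ^+ 2 <= (\sum_i a i ^+ 2) * (\sum_i b i ^+ 2).
Proof.
have : 0 <= \sum_i \sum_j (a i * b j - a j * b i) ^+ 2.
  by apply: sumr_ge0 => i _; apply: sumr_ge0 => j _; exact: sqr_ge0.
have -> : \sum_i \sum_j (a i * b j - a j * b i) ^+ 2 =
    \sum_i \sum_j a i ^+ 2 * b j ^+ 2 + \sum_i \sum_j b i ^+ 2 * a j ^+ 2 -
    2 * \sum_i \sum_j (a i * b i) * (a j * b j).
  rewrite mulr_sumr -big_split -sumrB/=; apply: eq_bigr => i _.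
  rewrite mulr_sumr -big_split -sumrB/=; apply: eq_bigr => j _.
  by ring.
have dist (f g : 'I_n -> R) :
    \sum_i \sum_j f i * g j = (\sum_i f i) * (\sum_i g i).
  by rewrite mulr_suml; apply: eq_bigr => i _; rewrite mulr_sumr.
rewrite !dist expr2 [(\sum_i b i ^+ 2) * _]mulrC => h.
by rewrite -subr_ge0; lra.
Qed.

Lemma norm_sum_scale_le (R : realType) (V : normedModType R) (n : nat)
    (c : 'I_n -> R) (y : 'I_n -> V) :
  `|\sum_i c i *: y i| ^+ 2 <= (\sum_i c i ^+ 2) * (\sum_i `|y i| ^+ 2).
Proof.
have -> : \sum_i c i ^+ 2 = \sum_i `|c i| ^+ 2.
  by apply: eq_bigr => i _; rewrite real_normK ?num_real.
apply: le_trans (cauchy_schwarz_sum _ _).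
rewrite lerXn2r ?nnegrE// ?sumr_ge0//.
by rewrite (le_trans (ler_norm_sum _ _ _))//; apply: ler_sum => i _;
  rewrite normrZ.
Qed.

(** The admissible indices form an initial segment because the eigenvalues decrease, and a bounded
    one because they vanish from [n] on. So the maximum exists and membership can be tested index by
    index. The clause [lam j != 0] is the convention $a/0=+\infty$. *)
Lemma truncation_levelP (R : realType) (lam : nat -> R) (n : nat) (m : R) j :
  (forall i, 0 <= lam i) -> (forall i j, (i <= j)%N -> lam j <= lam i) ->
  (forall i, (n <= i)%N -> lam i = 0) ->
  (j < truncation_level lam m)%N = (lam j != 0) && (lam 0 <= m * lam j).
Proof.
move=> lam0 lamS lamn.
set A := [set j | (0 < j)%N /\ (ediv (lam 0%N) (lam j.-1) <= m%:E)%E].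
have AP i : A i.+1 <-> (lam i != 0) && (lam 0 <= m * lam i).
  rewrite /A/= /ediv; case: eqVneq => [li|li]; first by split => // -[].
  rewrite lee_fin ler_pdivrMr; last by rewrite lt_def li lam0.
  by split => [[]|].
have Adown i k : (i <= k)%N -> A k.+1 -> A i.+1.
  move=> ik /AP/andP[lk hk]; apply/AP; have := lamS _ _ ik => lik.
  have lk0 : 0 < lam k by rewrite lt_def lk lam0.
  have li0 : 0 < lam i by exact: lt_le_trans lik.
  rewrite gt_eqF//=; apply: (le_trans hk); rewrite ler_wpM2l//.
  (* The sign of [m] is not given, but an admissible index forces [m >= 0]: otherwise
     [lam 0 <= m * lam k < 0]. *)
  rewrite leNgt; apply/negP => m0.
  by have := lam0 0%N; rewrite leNgt (le_lt_trans hk)// nmulr_rlt0.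
have Abnd k : A k -> (k <= n)%N.
  case: k => // k /AP/andP[lk _]; rewrite ltnNge; apply: contra_neqN lk.
  exact: lamn.
have An0 : ~ A 0%N by case.
suff : (j < truncation_level lam m)%N <-> A j.+1.
  move=> jA; apply/idP/idP => [/jA/AP//|/AP/jA//].
rewrite /truncation_level /nat_max -/A.
have [[k Ak]|Aempty] := pselect (exists k, A k); last first.
  rewrite xgetPN => [|k [Ak _]]; last by apply: Aempty; exists k.
  by split => // Aj; exfalso; apply: Aempty; exists j.+1.
have [K AK Kmax] : exists2 K, A K & forall j, A j -> (j <= K)%N.
  have ex : exists k, `[< A k >] by exists k; apply/asboolP.
  have bnd i : `[< A i >] -> (i <= n)%N by move/asboolP/Abnd.
  case: (ex_maxnP ex bnd) => K /asboolP AK Kmax; exists K => // i Ai.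
  by apply: Kmax; apply/asboolP.
have -> : xget 0%N [set k0 | A k0 /\ (forall j0, A j0 -> (j0 <= k0)%N)] = K.
  apply: xget_unique => // y [Ay ymax].
  by apply/eqP; rewrite eqn_leq Kmax// ymax.
split => [jK|/Kmax//].
case: K AK jK {Kmax} => // K AK jK; exact: (Adown j K).
Qed.

Section truncated_estimator_bound.
Context (R : realType) (T : Type) (H1 H2 : hilbertType R).
Variables (Psi : {linear H1 -> H2}) (X : nat -> T -> H1) (eps Y : nat -> T ->
  H2).
Variables (n : nat) (w : T) (lam : nat -> R) (v : nat -> H1) (m : R).
Local Notation Chat := (empirical_tensor X X n w).
Local Notation Ehat := (empirical_tensor X eps n w).
Hypothesis eigChat : eigensystem Chat lam v.
Hypothesis YE : forall k, (0 < k)%N -> Y k w = Psi (X k w) + eps k w.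
Local Notation K := (truncation_level lam m).

Let lam0 : forall j, 0 <= lam j. Proof. by case: eigChat. Qed.
Let lamS : forall i j, (i <= j)%N -> lam j <= lam i.
Proof. by case: eigChat. Qed.
Let v_on : forall i j, inner (v i) (v j) = (i == j)%:R.
Proof. by case: eigChat. Qed.
Let Cv : forall j, Chat (v j) = lam j *: v j. Proof. by case: eigChat. Qed.
Let lamn := eigenvalue_eq0 eigChat.
Let KP j := @truncation_levelP _ lam n m j lam0 lamS lamn.

Lemma truncation_level_le : (K <= n)%N.
Proof.
rewrite leqNgt; apply/negP; rewrite KP => /andP[].
by rewrite lamn// eqxx.
Qed.

Definition truncated_inverse (x : H1) : H1 :=
  \sum_(j < K) ((lam j)^-1 * inner (v j) x) *: v j.

Lemma truncated_estimatorE x :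
  truncated_estimator (empirical_tensor X Y n w) lam v K x =
  empirical_tensor X Y n w (truncated_inverse x).
Proof.
rewrite empirical_tensor_sum; apply: eq_bigr => j _.
by rewrite scalerA mulrC.
Qed.

Lemma empirical_tensor_response u :
  empirical_tensor X Y n w u = Psi (Chat u) + Ehat u.
Proof.
rewrite !empirical_tensorE linearZ [Psi _]linear_sum -scalerDr -big_split/=.
congr (_ *: _); apply: eq_big_nat => k /andP[k0 _].
by rewrite YE// linearZ/= scalerDr.
Qed.

Lemma empirical_tensor_truncated_inverse x :
  Chat (truncated_inverse x) = proj_on v K x.
Proof.
rewrite empirical_tensor_sum; apply: eq_bigr => j _.
have := ltn_ord j; rewrite KP => /andP[lj _].
by rewrite Cv scalerA mulrAC mulVf// mul1r.
Qed.

(** The left side is the squared Hilbert-Schmidt norm of [Ehat], which vanishes on the orthogonal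
    complement of the sample. Parseval on the span of [v 0], ..., [v n.-1], which contains the
    sample, eliminates the eigenvectors and leaves a quantity whose expectation can be estimated. *)
Lemma sum_sqr_norm_Ehat : \sum_(j < n) `|Ehat (v j)| ^+ 2 =
  n%:R ^- 2 * \sum_(1 <= k < n.+1) \sum_(1 <= l < n.+1)
    inner (X k w) (X l w) * inner (eps k w) (eps l w).
Proof.
transitivity (\sum_(j < n) n%:R ^- 2 *
    \sum_(1 <= k < n.+1) \sum_(1 <= l < n.+1)
    (inner (v j) (X k w) * inner (v j) (X l w)) * inner (eps k w) (eps l w)).
  apply: eq_bigr => j _; rewrite -inner_norm inner_empirical_tensor.
  rewrite -exprVn expr2 -mulrA; congr (_ * _); rewrite mulr_sumr.
  apply: eq_bigr => k _; rewrite (innerC (eps k w)) inner_empirical_tensor.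
  rewrite mulrCA; congr (_ * _); rewrite mulr_sumr; apply: eq_bigr => l _.
  by rewrite !(innerC (v j)) (innerC (eps k w)) mulrA.
rewrite -mulr_sumr; congr (_ * _).
rewrite exchange_big; apply: eq_big_nat => k kn.
rewrite exchange_big; apply: eq_bigr => l _.
by rewrite -mulr_suml (sum_inner_eigenvectors eigChat).
Qed.

Lemma inv_eigenvalue_le j : (j < K)%N -> (lam j)^-1 <= m / lam 0.
Proof.
rewrite KP => /andP[lj ml].
have lj0 : 0 < lam j by rewrite lt_def lj lam0.
have l00 : 0 < lam 0 by exact: lt_le_trans (lamS (leq0n j)).
by rewrite ler_pdivlMr// mulrC ler_pdivrMr.
Qed.

Lemma Ehat_truncated_inverse_le x : 0 <= m ->
  `|Ehat (truncated_inverse x)| ^+ 2 <= (m / lam 0 * `|x|) ^+ 2 *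
  (n%:R ^- 2 * \sum_(1 <= k < n.+1) \sum_(1 <= l < n.+1)
    inner (X k w) (X l w) * inner (eps k w) (eps l w)).
Proof.
move=> m0; rewrite empirical_tensor_sum (le_trans (norm_sum_scale_le _ _))//.
rewrite -sum_sqr_norm_Ehat; apply: ler_pM.
- by apply: sumr_ge0 => i _; exact: sqr_ge0.
- by apply: sumr_ge0 => i _; exact: sqr_ge0.
- rewrite exprMn (le_trans _ (ler_wpM2l (sqr_ge0 _) (bessel v_on K x)))//.
  rewrite mulr_sumr ler_sum// => j _; rewrite exprMn ler_wpM2r ?sqr_ge0//.
  by rewrite lerXn2r ?nnegrE ?invr_ge0// ?divr_ge0// inv_eigenvalue_le.
rewrite (big_ord_widen n (fun j => `|Ehat (v j)| ^+ 2) truncation_level_le).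
by rewrite big_mkcond ler_sum// => j _; case: ifP => // _; exact: sqr_ge0.
Qed.

Lemma proj_on_spectral_tail z : 0 < m ->
  `|Chat z - proj_on v K (Chat z)| <= lam 0 / m * `|z|.
Proof.
move=> m0; have ml0 : 0 <= lam 0 / m by rewrite divr_ge0// ltW.
rewrite -(@ler_pXn2r _ 2) ?nnegrE ?mulr_ge0//.
have -> : Chat z - proj_on v K (Chat z) =
    \sum_(j < n) (if (j < K)%N then 0 else lam j * inner (v j) z) *: v j.
  rewrite {1}(spectral_decomposition eigChat).
  rewrite /proj_on (big_ord_widen n (fun j =>
    inner (v j) (Chat z) *: v j) truncation_level_le).
  rewrite (big_mkcond (fun i : 'I_n => (i < K)%N)) -sumrB;
    apply: eq_bigr => j _.
  case: ifP => _; last by rewrite subr0.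
  by rewrite (innerC (v j) (Chat z)) (inner_empirical_tensor_eigenvector
    eigChat) subrr scale0r.
rewrite (sqr_norm_sum_orthonormal v_on n
  (fun j => if (j < K)%N then 0 else lam j * inner (v j) z)).
rewrite exprMn (le_trans _ (ler_wpM2l (sqr_ge0 _) (bessel v_on n z)))//.
rewrite mulr_sumr ler_sum// => j _; case: ifPn => [_|].
  by rewrite expr0n/= mulr_ge0 ?sqr_ge0.
rewrite KP negb_and negbK => jK; rewrite exprMn ler_wpM2r ?sqr_ge0//.
rewrite lerXn2r ?nnegrE ?divr_ge0// ?(ltW m0)// ler_pdivlMr//.
  case/orP: jK => [/eqP->|]; first by rewrite mul0r.
  by rewrite -ltNge mulrC => /ltW.
by rewrite invr_ge0 ltW.
Qed.

Lemma proj_on_residual (C : H1 -> H1) x u z : 0 < m ->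
  `|x - proj_on v K x| <=
  `|x - u| + `|u - C z| + `|Chat z - C z| + lam 0 / m * `|z|.
Proof.
move=> m0; have -> : x - proj_on v K x =
    (x - Chat z - proj_on v K (x - Chat z)) + (Chat z - proj_on v K (Chat z)).
  by rewrite proj_onB opprB addrAC (addrA _ (Chat z)) subrK addrA subrK.
rewrite (le_trans (ler_normD _ _))// lerD ?proj_on_spectral_tail//.
rewrite (le_trans (proj_on_contract v_on _ _))//.
have -> : x - Chat z = (x - u) + (u - C z) - (Chat z - C z).
  by rewrite opprB (addrA _ u) subrK addrA subrK.
by rewrite (le_trans (ler_normB _ _))// lerD2r ler_normD.
Qed.

(** The bound contains neither [K] nor [v]. All that is left of the spectrum is [lam 0], which the
    trace bounds from above and a Rayleigh quotient from below. *)
Lemma prediction_error_le (M : R) (C : H1 -> H1) x u z :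
  0 < m -> 0 <= M -> (forall y, `|Psi y| <= M * `|y|) ->
  `|Psi x - truncated_estimator (empirical_tensor X Y n w) lam v K x| <=
  M * (`|x - u| + `|u - C z| + `|Chat z - C z| + lam 0 / m * `|z|) +
  m / lam 0 * `|x| * Num.sqrt (n%:R ^- 2 *
    \sum_(1 <= k < n.+1) \sum_(1 <= l < n.+1)
    inner (X k w) (X l w) * inner (eps k w) (eps l w)).
Proof.
move=> m0 M0 PsiM.
rewrite truncated_estimatorE empirical_tensor_response.
rewrite empirical_tensor_truncated_inverse opprD addrA -linearB.
rewrite (le_trans (ler_normB _ _))// lerD//.
  by rewrite (le_trans (PsiM _))// ler_wpM2l// proj_on_residual.
rewrite -[leLHS]ger0_norm// -sqrtr_sqr.
rewrite -[X in X * Num.sqrt _]ger0_norm ?mulr_ge0 ?divr_ge0// ?(ltW m0)//.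
rewrite -[X in X * Num.sqrt _]sqrtr_sqr -sqrtrM ?sqr_ge0// ler_wsqrtr//.
by rewrite Ehat_truncated_inverse_le// ltW.
by rewrite invr_ge0.
Qed.

End truncated_estimator_bound.

(** * Polynomial approximation of the truncated inverse *)

Lemma bernoulli_ineq (R : realDomainType) (a : R) (k : nat) :
  -1 <= a -> 1 + k%:R * a <= (1 + a) ^+ k.
Proof.
move=> a1; elim: k => [|k IH]; first by rewrite mul0r addr0 expr0.
rewrite exprS (le_trans _ (ler_wpM2l _ IH))//; last by lra.
by rewrite -natr1; have := ler0n R k; have := sqr_ge0 a; nra.
Qed.

(** With [s = sqrt r] the sequence is [(k s^k) s^k]. Bernoulli's inequality for [s^-1 - 1] bounds
    the first factor, and the second tends to 0. *)
Lemma cvg_natr_geometric (R : realType) (r : R) : 0 <= r -> r < 1 ->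
  k%:R * r ^+ k @[k --> \oo] --> 0.
Proof.
rewrite le_eqVlt => /predU1P[<- _|r0 r1].
  apply: cvg_near_cst; exists 1%N => // k /= k1.
  by rewrite expr0n gtn_eqF// mulr0.
set s := Num.sqrt r.
have s0 : 0 < s by rewrite sqrtr_gt0.
have s1 : s < 1 by rewrite -[ltRHS]sqrtr1 ltr_sqrt.
have c0 : 0 < s^-1 - 1 by rewrite subr_gt0 invf_gt1.
have ks k : k%:R * s ^+ k <= (s^-1 - 1)^-1.
  rewrite -[leRHS]mul1r ler_pdivlMr// mulrAC -ler_pdivlMr ?exprn_gt0//
    mul1r -exprVn.
  have := @bernoulli_ineq R (s^-1 - 1) k; rewrite addrCA subrr addr0 => b.
  by apply: le_trans (b _); [rewrite lerDr|lra].
apply: (@squeeze_cvgr _ _ _ _ (fun=> 0) (fun k => (s^-1 - 1)^-1 * s ^+ k)).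
- near=> k; rewrite mulr_ge0// ?exprn_ge0// ?(ltW r0)//=.
  rewrite -(sqr_sqrtr (ltW r0)) -/s -exprM mulnC exprM expr2 mulrA.
  by rewrite ler_wpM2r ?exprn_ge0// ltW.
- exact: cvg_cst.
- by have := @cvg_geometric R (s^-1 - 1)^-1 s; apply; rewrite ger0_norm// ltW.
Unshelve. all: by end_near. Qed.

(* [(1 - x ^+ k) ^+ E] with [k * m ^+ k <= E <= k * m ^+ k + 1] tends to the
   indicator of [x < m^-1] on the unit interval, the threshold included in the
   zero set thanks to the factor k. *)
Definition cut_exponent (R : realType) (m : R) (k : nat) : nat :=
  (Num.trunc (k%:R * m ^+ k)).+1.

(** A partial Neumann series for [x^-1] times a polynomial approximation of the indicator of
    [m * x >= 1]. At [x = 0] the series diverges, but the second factor is exactly 0 for positive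
    [k]. *)
Definition inverse_approx_scalar (R : realType) (m : R) (k : nat) (x : R) : R :=
  (\sum_(i < k) (1 - x) ^+ i) * (1 - (1 - x ^+ k) ^+ cut_exponent m k).

(** Bernoulli's inequality works on both sides of the threshold. With [t = x^k] and [E] the
    exponent, [(1 - t)^E >= 1 - E t], where [E t <= k (m x)^k + x^k] tends to 0 if [m x < 1]. If
    [m x >= 1], then [E t >= k], and [(1 - t)^E (1 + E t) <= (1 - t^2)^E <= 1] bounds the power by
    [1 / (k + 1)]. *)
Lemma cvg_cut (R : realType) (m x : R) : 1 <= m -> 0 <= x <= 1 ->
  (1 - x ^+ k) ^+ cut_exponent m k @[k --> \oo] --> ((m * x < 1)%R%:R : R).
Proof.
move=> m1 /andP[x0 x1].
have m0 : 0 < m by exact: lt_le_trans m1.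
have xk k : 0 <= x ^+ k <= 1 by rewrite exprn_ge0// exprn_ile1.
have base k : 0 <= 1 - x ^+ k <= 1 by case/andP: (xk k); lra.
have kmk k : 0 <= k%:R * m ^+ k by rewrite mulr_ge0// exprn_ge0// ltW.
have [mx|mx] := ltP (m * x) 1.
- have xlt1 : x < 1 by apply: le_lt_trans mx; rewrite ler_peMl.
  apply: (@squeeze_cvgr _ _ _ _
    (fun k => 1 - (k%:R * (m * x) ^+ k + x ^+ k)) (fun=> 1)).
  + near=> k; have /andP[b0 b1] := base k; rewrite exprn_ile1// andbT.
    have := @bernoulli_ineq R (- x ^+ k) (cut_exponent m k).
    case/andP: (xk k) => xk0 xk1; rewrite lerN2 => /(_ xk1).
    apply: le_trans; rewrite mulrN lerB//
      exprMn mulrA -[X in _ + X]mul1r -mulrDl.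
    by rewrite ler_wpM2r// -natr1 lerD2r truncn_le.
  + rewrite -[X in _ --> X]subr0 -[X in _ --> _ - X]addr0.
    apply: cvgB; first exact: cvg_cst.
    apply: cvgD; first by apply: cvg_natr_geometric => //;
      rewrite mulr_ge0// ltW.
    by apply: cvg_expr; rewrite ger0_norm.
  + exact: cvg_cst.
- apply: (@squeeze_cvgr _ _ _ _ (fun=> 0) (fun k => harmonic k)).
  + near=> k; have /andP[b0 b1] := base k; rewrite exprn_ge0//=.
    set E := cut_exponent m k; set t := x ^+ k.
    have /andP[t0 t1] : 0 <= t <= 1 by exact: xk.
    rewrite /harmonic/= -[leRHS]mul1r ler_pdivlMr//.
    have Et : k.+1%:R <= 1 + E%:R * t.
      rewrite -natr1 addrC lerD2l (@le_trans _ _ (k%:R * (m * x) ^+ k))//.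
        by rewrite ler_peMr// exprn_ege1.
      rewrite exprMn mulrA ler_wpM2r// ltW// /E /cut_exponent.
      by have /andP[] := truncn_itv (kmk k).
    have p0 : 0 <= (1 - t) ^+ E by exact: exprn_ge0.
    have tN1 : -1 <= t by lra.
    apply: (le_trans (ler_wpM2l p0 Et)).
    apply: (le_trans (ler_wpM2l p0 (bernoulli_ineq E tN1))).
    by rewrite -exprMn exprn_ile1//; nra.
  + exact: cvg_cst.
  + exact: cvg_harmonic.
Unshelve. all: by end_near. Qed.

Lemma cvg_inverse_approx_scalar (R : realType) (m x : R) :
  1 <= m -> 0 <= x <= 1 ->
  inverse_approx_scalar m k x @[k --> \oo] -->
    (if 1 <= m * x then x^-1 else 0).
Proof.
move=> m1 /andP[]; rewrite le_eqVlt => /predU1P[<- _|x0 x1].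
  rewrite mulr0 ler10; apply: cvg_near_cst; exists 1%N => // k /= k1.
  by rewrite /inverse_approx_scalar expr0n gtn_eqF// subr0 expr1n subrr mulr0.
have -> : (if 1 <= m * x then x^-1 else 0) = x^-1 * (1 - (m * x < 1)%R%:R).
  by rewrite ltNge; case: ifP => _; rewrite ?subr0 ?mulr1// subrr mulr0.
apply: cvgM.
  have -> : (fun k => \sum_(i < k) (1 - x) ^+ i) = series (geometric 1 (1 - x)).
    apply/funext => k; rewrite /series/= big_mkord.
    by apply: eq_bigr => i _; rewrite mul1r.
  have := @cvg_geometric_series R 1 (1 - x).
  have -> : 1 - (1 - x) = x by ring.
  rewrite mul1r; apply.
  by rewrite ltr_norml; lra.
by apply: cvgB; [exact: cvg_cst|apply: cvg_cut => //; rewrite (ltW x0)].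
Qed.

(** The polynomial [inverse_approx_scalar] with iterates of [B] in place of powers of [x], so that
    it can be evaluated without eigenvectors. *)
Definition inverse_approx (V : zmodType) (B : V -> V) (k E : nat) (u : V) : V :=
  \sum_(i < k) iter i (fun y => y - B y)
    (u - iter E (fun y => y - iter k B y) u).

Section polynomial_calculus.
Context (R : realType) (T : Type) (H : hilbertType R).
Variables (X : nat -> T -> H) (n : nat) (w : T) (lam : nat -> R) (v : nat -> H).
Local Notation Chat := (empirical_tensor X X n w).
Hypothesis eigChat : eigensystem Chat lam v.

Let lam0 : forall j, 0 <= lam j. Proof. by case: eigChat. Qed.
Let lamS : forall i j, (i <= j)%N -> lam j <= lam i.
Proof. by case: eigChat. Qed.
Let v_on : forall i j, inner (v i) (v j) = (i == j)%:R.
Proof. by case: eigChat. Qed.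

(** The scaling puts the spectrum into the unit interval, where the polynomials converge, and turns
    the cut-off [lam 0 / lam j <= m] into the deterministic threshold [m^-1]. *)
Definition normalized (u : H) : H := (lam 0)^-1 *: Chat u.

Let mu j := (lam 0)^-1 * lam j.

(** Functional calculus of [normalized]. Its kernel contains the orthogonal complement of [v 0],
    ..., [v n.-1], so [phi] acts there as the scalar [phi 0]; a multiple of the identity plus a
    correction of finite rank expresses this without a basis of the complement. *)
Let fc (phi : R -> R) (u : H) : H := phi 0 *: u +
  \sum_(j < n) ((phi (mu j) - phi 0) * inner (v j) u) *: v j.

Let inner_fc phi u j : (j < n)%N ->
  inner (v j) (fc phi u) = phi (mu j) * inner (v j) u.
Proof.
move=> jn; rewrite innerDr innerZr (innerC _ (\sum_(_ < _) _)).
rewrite (inner_sum_orthonormal v_on n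
  (fun j => (phi (mu j) - phi 0) * inner (v j) u)) jn.
by rewrite -mulrDl addrC subrK.
Qed.

Let fc_comp phi psi u : fc phi (fc psi u) = fc (fun x => phi x * psi x) u.
Proof.
rewrite {1}/fc [in phi 0 *: _]/fc scalerDr scalerA -addrA /fc; congr (_ + _).
rewrite scaler_sumr -big_split; apply: eq_bigr => j _ /=.
rewrite scalerA -scalerDl inner_fc//; congr (_ *: _); ring.
Qed.

Let fcD phi psi u : fc phi u + fc psi u = fc (fun x => phi x + psi x) u.
Proof.
rewrite /fc addrACA -scalerDl -big_split; congr (_ + _).
by apply: eq_bigr => j _ /=; rewrite -scalerDl; congr (_ *: _); ring.
Qed.

Let fcN phi u : - fc phi u = fc (fun x => - phi x) u.
Proof.
rewrite /fc opprD -scaleNr -sumrN; congr (_ + _); apply: eq_bigr => j _.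
by rewrite -scaleNr; congr (_ *: _); ring.
Qed.

Let fc1 u : fc (fun=> 1) u = u.
Proof.
rewrite /fc scale1r big1 ?addr0// => j _.
by rewrite subrr mul0r scale0r.
Qed.

Let fc_sum (I : Type) (r : seq I) (phi : I -> R -> R) u :
  \sum_(i <- r) fc (phi i) u = fc (fun x => \sum_(i <- r) phi i x) u.
Proof.
elim: r => [|i r IH].
  rewrite big_nil /fc big_nil scale0r add0r big1// => j _.
  by rewrite !big_nil subrr mul0r scale0r.
by rewrite big_cons IH fcD; congr (fc _ _); apply/funext => x; rewrite big_cons.
Qed.

Let fc_iter (A : H -> H) phi k u : (forall y, A y = fc phi y) ->
  iter k A u = fc (fun x => phi x ^+ k) u.
Proof.
move=> AE; elim: k => [|k IH]; first by rewrite fc1.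
rewrite iterS IH AE fc_comp; congr (fc _ _); apply/funext => x.
by rewrite exprS.
Qed.

Let fc_id u : normalized u = fc id u.
Proof.
rewrite /normalized (spectral_decomposition eigChat) /fc scale0r add0r
  scaler_sumr.
by apply: eq_bigr => j _; rewrite scalerA mulrA subr0.
Qed.

Let fc_compl (A : H -> H) phi u : (forall y, A y = fc phi y) ->
  u - A u = fc (fun x => 1 - phi x) u.
Proof. by move=> AE; rewrite -[X in X - _]fc1 AE fcN fcD. Qed.

Lemma inverse_approx_normalized m k u :
  inverse_approx normalized k (cut_exponent m k) u =
  fc (inverse_approx_scalar m k) u.
Proof.
rewrite /inverse_approx.
have E1 y : y - iter k normalized y = fc (fun x => 1 - x ^+ k) y.
  by rewrite (@fc_compl _ (fun x => x ^+ k))// => z; apply: fc_iter => t;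
    exact: fc_id.
rewrite (@fc_compl _ (fun x => (1 - x ^+ k) ^+ cut_exponent m k)); last first.
  by move=> y; apply: fc_iter.
under eq_bigr => i _.
  rewrite (@fc_iter _ (fun x => 1 - x)); last by move=> y; apply: fc_compl.
  rewrite fc_comp; over.
rewrite fc_sum; congr (fc _ _); apply/funext => x.
by rewrite /inverse_approx_scalar mulr_suml.
Qed.

Lemma cvg_inverse_approx (m : R) u h : 1 <= m ->
  inner ((lam 0)^-1 *:
    inverse_approx normalized k (cut_exponent m k) u) h @[k --> \oo] -->
  inner (truncated_inverse lam v m u) h.
Proof.
move=> m1.
have m0 : 0 < m by exact: lt_le_trans m1.
(* If [lam 0 = 0], no index is admissible and both sides are 0, because [0^-1 = 0]. *)
have [l0|l0] := eqVneq (lam 0) 0.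
  have -> : truncated_inverse lam v m u = 0.
    rewrite /truncated_inverse big1// => j _; have := ltn_ord j.
    rewrite (truncation_levelP _ _ lam0 lamS (eigenvalue_eq0 eigChat)).
    by rewrite eq_le lam0 andbT -l0 lamS.
  under eq_fun do rewrite l0 invr0 scale0r.
  by rewrite inner0l; exact: cvg_cst.
have l00 : 0 < lam 0 by rewrite lt_def l0 lam0.
have -> : inner (truncated_inverse lam v m u) h = (lam 0)^-1 * (0 * inner u h +
    \sum_(j < n) ((if 1 <= m * mu j then (mu j)^-1 else 0) - 0) *
      inner (v j) u * inner (v j) h).
  rewrite mul0r add0r mulr_sumr.
  rewrite /truncated_inverse (big_ord_widen n (fun j =>
    ((lam j)^-1 * inner (v j) u) *: v j)
    (truncation_level_le m eigChat)).
  rewrite big_mkcond inner_suml; apply: eq_bigr => j _.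
  rewrite (truncation_levelP _ _ lam0 lamS (eigenvalue_eq0 eigChat)) subr0.
  have -> : (1 <= m * mu j) = (lam j != 0) && (lam 0 <= m * lam j).
    rewrite /mu mulrCA mulrC ler_pdivlMr// mul1r.
    have [->|//] := eqVneq (lam j) 0; by rewrite mulr0 leNgt l00.
  case: ifP => [/andP[lj _]|_]; last by rewrite inner0l !mul0r mulr0.
  by rewrite innerZl /mu; field; rewrite lj l0.
under eq_fun => k do rewrite innerZl inverse_approx_normalized innerDl innerZl
  inner_suml.
have mu01 j : 0 <= mu j <= 1.
  rewrite /mu mulr_ge0 ?invr_ge0//= mulrC ler_pdivrMr// mul1r; exact: lamS.
have lim0 : inverse_approx_scalar m k 0 @[k --> \oo] --> 0.
  have := @cvg_inverse_approx_scalar R m 0 m1.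
  by rewrite mulr0 ler10 lexx ler01; apply.
apply: cvgM; first exact: cvg_cst.
apply: cvgD; first by apply: cvgM => //; exact: cvg_cst.
apply: cvg_big => [|j _]; first exact: add_continuous.
under eq_fun do rewrite innerZl.
apply: cvgM; last exact: cvg_cst.
apply: cvgM; last exact: cvg_cst.
by apply: cvgB => //; exact: cvg_inverse_approx_scalar.
Qed.

End polynomial_calculus.

(** * Measurability in Hilbert spaces *)

Lemma separable_enumeration (R : realType) (V : normedModType R) :
  separable V ->
  exists u : nat -> V, forall x e, 0 < e -> exists k, `|x - u k| < e.
Proof.
case=> D cD dD.
have near_D x e : 0 < e -> exists2 y, D y & `|x - y| < e.
  move=> e0; have [||y [xy Dy]] := dD (ball x e).
  - by exists x; exact: ballxx.
  - exact: ball_open.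
  - by exists y => //; move: xy; rewrite -ball_normE.
have [y0 Dy0 _] := near_D 0 1 ltr01.
have D0 : D !=set0 by exists y0.
have /pfcard_geP[D0'|[f]] : (D #<= [set: nat])%card by [].
  by case: D0 => y; rewrite D0'.
exists f => x e /(near_D x)[y Dy xy].
by have [k _ fk] := 'surj_f Dy; exists k; rewrite fk.
Qed.

Section real_measurability.
Context (R : realType) d (T : measurableType d).

Lemma measurable_fun_sublevel (f : T -> R) :
  (forall c, measurable [set w | f w <= c]) -> measurable_fun setT f.
Proof.
move=> mf; apply: (measurability (@RGenOInfty.G R)) => [|/= _ [_] [r] -> <-].
  exact: RGenOInfty.measurableE.
rewrite setTI; have -> : f @^-1` `]r, +oo[%classic = ~` [set w | f w <= r].
  apply/seteqP; split => w /=; rewrite in_itv/= andbT.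
    by move=> rf; apply/negP; rewrite -ltNge.
  by move/negP; rewrite -ltNge.
exact: measurableC.
Qed.

Lemma measurable_le (f g : T -> R) :
  measurable_fun setT f -> measurable_fun setT g ->
  measurable [set w | f w <= g w].
Proof.
move=> mf mg; rewrite -[X in measurable X]setTI.
exact: (measurable_fun_ler mf mg measurableT (_ : measurable [set true])).
Qed.

Lemma measurable_lt (f g : T -> R) :
  measurable_fun setT f -> measurable_fun setT g ->
  measurable [set w | f w < g w].
Proof.
move=> mf mg; have -> : [set w | f w < g w] = ~` [set w | g w <= f w].
  by apply/seteqP; split => w /=; rewrite ltNge => /negP.
by apply: measurableC; exact: measurable_le.
Qed.

End real_measurability.

(** Measurability tested against vectors passes to sums and pointwise limits at once, with no
    discussion of Borel sets of a product. Separability then recovers what the proof needs, namely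
    measurable norms and inner products. *)
Definition weakly_measurable (R : realType) d (T : measurableType d)
    (H : hilbertType R) (Z : T -> H) : Prop :=
  forall h, measurable_fun setT (fun w => inner (Z w) h).

Lemma continuous_inner (R : realType) (H : hilbertType R) (h : H) :
  continuous (fun x => inner x h).
Proof.
move=> x; apply/cvgrPdist_lt => /= e e0.
have h1 : 0 < `|h| + 1 by rewrite ltr_wpDl.
near=> y; rewrite -innerBl (le_lt_trans (cauchy_schwarz _ _))//.
rewrite (@le_lt_trans _ _ (`|x - y| * (`|h| + 1)))// ?ler_wpM2l ?lerDl//.
rewrite -ltr_pdivlMr//; near: y; apply: cvgr_dist_lt; first by [].
by rewrite divr_gt0.
Unshelve. all: by end_near. Qed.

Section weak_measurability.
Context (R : realType) d (T : measurableType d) (H : hilbertType R).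
Implicit Types Z W : T -> H.

Lemma measurable_fun_borel (H' : hilbertType R) (f : H -> H') Z :
  continuous f -> measurable_fun setT (Z : T -> borel H) ->
  measurable_fun setT (f \o Z : T -> borel H').
Proof.
move=> /continuousP cf mZ;
  apply: (measurability (@open H' : set (set (borel H')))) => //.
move=> _ [B oB <-]; rewrite setTI comp_preimage -[X in measurable X]setTI.
apply: mZ => //; apply: sub_sigma_algebra; exact: cf.
Qed.

Lemma borel_weakly_measurable Z :
  measurable_fun setT (Z : T -> borel H) -> weakly_measurable Z.
Proof.
move=> mZ h; apply: (measurability _ (RGenOpens.measurableE R)).
move=> _ [_ [a [b ->]] <-]; rewrite setTI.
have -> : (fun w => inner (Z w) h) @^-1` `]a, b[%classic =
    Z @^-1` ((fun x => inner x h) @^-1` `]a, b[%classic) by [].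
rewrite -[X in measurable X]setTI.
apply: mZ => //; apply: sub_sigma_algebra.
have /continuousP := @continuous_inner R H h; apply; exact: interval_open.
Qed.

Lemma weakly_measurable_comp d' (T' : measurableType d') (f : T' -> H)
    (g : T -> T') : measurable_fun setT g -> weakly_measurable f ->
  weakly_measurable (f \o g).
Proof. by move=> mg mf h; apply: (measurableT_comp (mf h) mg). Qed.

Lemma weakly_measurable_cst (x : H) : weakly_measurable (fun _ : T => x).
Proof. by move=> h; exact: measurable_cst. Qed.

Lemma weakly_measurableZ (a : T -> R) Z : measurable_fun setT a ->
  weakly_measurable Z -> weakly_measurable (fun w => a w *: Z w).
Proof.
move=> ma mZ h; under eq_fun do rewrite innerZl.
exact: measurable_funM.
Qed.

Lemma weakly_measurableD Z W : weakly_measurable Z -> weakly_measurable W ->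
  weakly_measurable (fun w => Z w + W w).
Proof.
move=> mZ mW h; under eq_fun do rewrite innerDl.
exact: measurable_funD.
Qed.

Lemma weakly_measurableB Z W : weakly_measurable Z -> weakly_measurable W ->
  weakly_measurable (fun w => Z w - W w).
Proof.
move=> mZ mW h; under eq_fun do rewrite innerBl.
exact: measurable_funB.
Qed.

Lemma weakly_measurable_sum (I : eqType) (r : seq I) (Z : I -> T -> H) :
  (forall i, i \in r -> weakly_measurable (Z i)) ->
  weakly_measurable (fun w => \sum_(i <- r) Z i w).
Proof.
move=> mZ h; under eq_fun do rewrite inner_suml.
elim: r mZ => [|i r IH] mZ.
  by under eq_fun do rewrite big_nil; exact: measurable_cst.
under eq_fun do rewrite big_cons; apply: measurable_funD.
  by apply: mZ; rewrite mem_head.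
by apply: IH => j jr; apply: mZ; rewrite inE jr orbT.
Qed.

Hypothesis sepH : separable H.

(** The norm is a countable supremum: [|Z w| <= c] holds iff [inner (Z w) (u k) <= c * |u k|] along
    a dense sequence. By density the inequality extends to every [h], and [h = Z w] gives the
    norm. *)
Lemma measurable_fun_normr Z : weakly_measurable Z ->
  measurable_fun setT (fun w => `|Z w|).
Proof.
have [u udense] := separable_enumeration sepH.
move=> mZ; apply: measurable_fun_sublevel => c.
have [c0|c0] := ltP c 0.
  rewrite [X in measurable X](_ : _ = set0)//; apply/seteqP; split => w //=.
  by move=> /le_lt_trans/(_ c0); rewrite normr_lt0.
have -> : [set w | `|Z w| <= c] =
    \bigcap_k [set w | inner (Z w) (u k) <= c * `|u k|].
  apply/seteqP; split => w /=.
    by move=> Zc k _ /=; rewrite (le_trans (inner_le _ _))// ler_wpM2r.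
  move=> Zu.
  have Zh h : inner (Z w) h <= c * `|h|.
    apply/ler_addgt0Pr => e e0.
    (* Replacing [h] by [u k] costs at most [(|Z w| + c) * |h - u k|]; the 1 keeps the divisor
       positive. *)
    have D0 : 0 < `|Z w| + c + 1 by rewrite ltr_wpDl// addr_ge0.
    have [k hk] := udense h (e / (`|Z w| + c + 1)) (divr_gt0 e0 D0).
    rewrite ltr_pdivlMr// in hk.
    have -> : inner (Z w) h = inner (Z w) (h - u k) + inner (Z w) (u k).
      by rewrite innerBr subrK.
    have h1 := inner_le (Z w) (h - u k).
    have h2 : inner (Z w) (u k) <= c * `|u k| by exact: Zu.
    have h3 : `|u k| <= `|h| + `|h - u k|.
      by have := ler_normB h (h - u k); rewrite subKr.
    have h4 := ler_wpM2l c0 h3.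
    have h5 := normr_ge0 (h - u k).
    nra.
  have [->|Z0] := eqVneq (Z w) 0; first by rewrite normr0.
  have := Zh (Z w); rewrite inner_norm expr2 ler_pM2r// normr_gt0//.
by apply: bigcap_measurableType => k _; apply: measurable_le.
Qed.

Lemma measurable_fun_inner Z W : weakly_measurable Z -> weakly_measurable W ->
  measurable_fun setT (fun w => inner (Z w) (W w)).
Proof.
move=> mZ mW; under eq_fun do rewrite inner_polarization.
apply: measurable_funM => //; apply: measurable_funB; apply: measurable_funX.
  by apply: measurable_fun_normr; exact: weakly_measurableD.
by apply: measurable_fun_normr; exact: weakly_measurableB.
Qed.

End weak_measurability.

Lemma measurable_fun_invr (R : realType) d (T : measurableType d) (f : T -> R) :
  (forall w, 0 <= f w) -> measurable_fun setT f ->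
  measurable_fun setT (fun w => (f w)^-1).
Proof.
move=> f0 mf; under eq_fun do rewrite -powR_inv1//.
exact: (measurableT_comp (measurable_powR _) mf).
Qed.

(** * Measurability of the estimator *)

Section estimator_measurability.
Context (R : realType) d (T : measurableType d) (H1 H2 : hilbertType R).
Hypothesis sepH1 : separable H1.
Variables (X : nat -> T -> H1) (Y : nat -> T -> H2) (n : nat).
Variables (lam : T -> nat -> R) (v : T -> nat -> H1).
Hypothesis mX : forall k, (0 < k)%N -> weakly_measurable (X k).
Hypothesis mY : forall k, (0 < k)%N -> weakly_measurable (Y k).
Hypothesis eigChat : forall w,
  eigensystem (empirical_tensor X X n w) (lam w) (v w).

Lemma weakly_measurable_empirical_tensor (Z : T -> H1) :
  weakly_measurable Z ->
  weakly_measurable (fun w => empirical_tensor X Y n w (Z w)).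
Proof.
move=> mZ; apply: weakly_measurableZ; first exact: measurable_cst.
apply: weakly_measurable_sum => k; rewrite mem_index_iota => /andP[k0 _].
apply: weakly_measurableZ; last exact: mY.
by apply: measurable_fun_inner => //; exact: mX.
Qed.

Lemma measurable_rayleigh u :
  measurable_fun setT (fun w => inner (empirical_tensor X X n w u) u).
Proof.
under eq_fun do rewrite inner_empirical_tensor.
apply: measurable_funM => //.
(* [mX] covers positive indices only, so the summand is redefined as 0 at index 0, which lies
   outside the range. *)
have -> : (fun w => \sum_(1 <= i < n.+1)
    inner (X i w) u * inner (X i w) u) =
    (fun w => \sum_(i <- index_iota 1 n.+1)
    (if (0 < i)%N then inner (X i w) u * inner (X i w) u else 0)).
  by apply/funext => w; apply: eq_big_nat => i /andP[-> _].
apply: measurable_sum => i; have [i0|//] := boolP (0 < i)%N.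
by apply: measurable_funM; exact: mX.
Qed.

(** The top eigenvalue is the supremum of the Rayleigh quotient, which is continuous, so a dense
    sequence suffices: if [lam w 0 > c], the strict inequality at [v w 0] persists at some [u k]
    nearby. No measurable choice of [v] enters. *)
Lemma measurable_top_eigenvalue : measurable_fun setT (fun w => lam w 0%N).
Proof.
have [u udense] := separable_enumeration sepH1.
apply: measurable_fun_sublevel => c.
have -> : [set w | lam w 0%N <= c] =
    \bigcap_k [set w | inner (empirical_tensor X X n w (u k)) (u k) <=
                       c * `|u k| ^+ 2].
  apply/seteqP; split => w /=.
    move=> lc k _ /=; rewrite (le_trans (rayleigh_le (eigChat w) _))//.
    by rewrite ler_wpM2r// sqr_ge0.
  move=> Hu; have [_ _ von _ _] := eigChat w.
  rewrite leNgt; apply/negP => lc.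
  pose f h := n%:R^-1 * \sum_(1 <= k < n.+1) (inner h (X k w) * inner h (X k w))
    - c * `|h| ^+ 2.
  have fE h : inner (empirical_tensor X X n w h) h - c * `|h| ^+ 2 = f h.
    rewrite inner_empirical_tensor; congr (_ * _ - _).
    by apply: eq_bigr => k _; rewrite (innerC h).
  have fc : continuous f.
    move=> h; apply: cvgB.
      apply: cvgM; first exact: cvg_cst.
      apply: cvg_big => [|k _]; first exact: add_continuous.
      by apply: cvgM; exact: continuous_inner.
    apply: cvgM; first exact: cvg_cst.
    by rewrite expr2; under eq_fun do rewrite expr2; apply: cvgM;
      exact: norm_continuous.
  have fv : 0 < f (v w 0%N).
    rewrite -fE -(top_eigenvalueE (eigChat w)) -inner_norm von eqxx mulr1.
    by rewrite subr_gt0.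
  have /cvgrPdist_lt/(_ _ fv)/nbhs_ballP[e /= e0 he] := fc (v w 0%N).
  have [k hk] := udense (v w 0%N) e e0.
  have := he (u k); rewrite -ball_normE/= => /(_ hk).
  have := Hu k I; rewrite /= -subr_le0 fE => fu.
  by rewrite ltr_norml => /andP[_]; rewrite ltrBlDr ltrDl ltNge fu.
apply: bigcap_measurableType => k _.
by apply: measurable_le => //; exact: measurable_rayleigh.
Qed.

End estimator_measurability.

Section inverse_approx_measurability.
Context (R : realType) d (T : measurableType d) (H : hilbertType R).
Variable B : T -> H -> H.
Hypothesis mB : forall Z : T -> H, weakly_measurable Z ->
  weakly_measurable (fun w => B w (Z w)).

Lemma weakly_measurable_iter (A : T -> H -> H) (k : nat) (Z : T -> H) :
  (forall Z' : T -> H, weakly_measurable Z' ->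
    weakly_measurable (fun w => A w (Z' w))) ->
  weakly_measurable Z -> weakly_measurable (fun w => iter k (A w) (Z w)).
Proof.
by move=> mA mZ; elim: k => //= k IH; exact: (mA (fun w => iter k (A w) (Z w))).
Qed.

Lemma weakly_measurable_inverse_approx k E (Z : T -> H) :
  weakly_measurable Z ->
  weakly_measurable (fun w => inverse_approx (B w) k E (Z w)).
Proof.
move=> mZ; apply: weakly_measurable_sum => i _.
apply: (weakly_measurable_iter (A := fun w y => y - B w y)) => [Z' mZ'|].
  by apply: weakly_measurableB => //; exact: mB.
apply: weakly_measurableB => //.
apply: (weakly_measurable_iter (A := fun w y => y - iter k (B w) y)) =>
  // Z' mZ'.
by apply: weakly_measurableB => //; exact: weakly_measurable_iter.
Qed.

End inverse_approx_measurability.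

Section prediction_measurability.
Context (R : realType) d (T : measurableType d) (H1 H2 : hilbertType R).
Hypothesis sepH1 : separable H1.
Variables (X : nat -> T -> H1) (Y : nat -> T -> H2) (n : nat).
Variables (lam : T -> nat -> R) (v : T -> nat -> H1) (m : R).
Hypothesis mX : forall k, (0 < k)%N -> weakly_measurable (X k).
Hypothesis mY : forall k, (0 < k)%N -> weakly_measurable (Y k).
Hypothesis eigChat : forall w,
  eigensystem (empirical_tensor X X n w) (lam w) (v w).

Lemma weakly_measurable_normalized (Z : T -> H1) : weakly_measurable Z ->
  weakly_measurable (fun w => normalized X n w (lam w) (Z w)).
Proof.
move=> mZ; apply: weakly_measurableZ.
  apply: measurable_fun_invr; first by move=> w; case: (eigChat w).
  exact: (measurable_top_eigenvalue sepH1 mX eigChat).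
exact: (weakly_measurable_empirical_tensor sepH1).
Qed.

(* The eigenvectors need not be chosen measurably, but the estimator does not
   depend on this choice: it is a pointwise limit of polynomials in the
   empirical covariance operator. *)
Lemma weakly_measurable_truncated_estimator (Z : T -> H1) : 1 <= m ->
  weakly_measurable Z ->
  weakly_measurable (fun w =>
    truncated_estimator (empirical_tensor X Y n w) (lam w) (v w)
      (truncation_level (lam w) m) (Z w)).
Proof.
move=> m1 mZ.
have -> : (fun w => truncated_estimator (empirical_tensor X Y n w) (lam w) (v w)
      (truncation_level (lam w) m) (Z w)) =
    (fun w => empirical_tensor X Y n w (truncated_inverse (lam w) (v w) m (Z
      w))).
  by apply/funext => w; exact: truncated_estimatorE.
apply: (weakly_measurable_empirical_tensor sepH1) => // h.
apply: (@measurable_fun_cvg _ _ _ _ (fun k w => inner ((lam w 0%N)^-1 *: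
    inverse_approx (normalized X n w (lam w)) k (cut_exponent m k) (Z w)) h));
      last first.
  by move=> w _; exact: (cvg_inverse_approx (eigChat w)).
move=> k; apply: weakly_measurableZ.
  apply: measurable_fun_invr; first by move=> w; case: (eigChat w).
  exact: (measurable_top_eigenvalue sepH1 mX eigChat).
apply: weakly_measurable_inverse_approx => // Z' mZ'.
exact: weakly_measurable_normalized.
Qed.

End prediction_measurability.

(** * Independent and identically distributed sequences *)

Definition mfun_of d d' (T : measurableType d) (T' : measurableType d')
    (f : T -> T') (mf : measurable_fun setT f) : {mfun T >-> T'} :=
  mfun_Sub (mem_set mf).

Section sequence_space_cylinders.
Context d (S : measurableType d).

(** The generating [cylinders] constrain one coordinate each and are not closed under intersection.
    Finite cylinders generate the same sigma-algebra and form the pi-system that uniqueness and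
    Dynkin arguments require. *)
Definition finite_cylinder (N : nat) (B : nat -> set S) : set (sequence_space
  S) :=
  [set s | forall i, (i < N)%N -> B i (s i)].

Definition finite_cylinders : set (set (sequence_space S)) :=
  [set A | exists N B, (forall i, measurable (B i)) /\ A = finite_cylinder N B].

Lemma measurable_coordinate i :
  measurable_fun setT (fun s : sequence_space S => s i : S).
Proof.
move=> _ B mB; rewrite setTI; apply: sub_sigma_algebra.
by exists i, B.
Qed.

Lemma measurable_finite_cylinder N B : (forall i, measurable (B i)) ->
  measurable (finite_cylinder N B).
Proof.
move=> mB.
have -> : finite_cylinder N B = \bigcap_(i in [set i | (i < N)%N])
    ((fun s : sequence_space S => s i : S) @^-1` B i).
  by apply/seteqP; split.
apply: bigcap_measurableType => i _.
by rewrite -[X in measurable X]setTI; exact: measurable_coordinate.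
Qed.

Lemma finite_cylinders_gen :
  @measurable _ (sequence_space S) = <<s finite_cylinders >>.
Proof.
apply/seteqP; split.
  apply: smallest_sub; first exact: smallest_sigma_algebra.
  move=> A [i [B [mB ->]]]; apply: sub_sigma_algebra.
  exists i.+1, (fun j => if j == i then B else setT); split.
    by move=> j; case: ifP.
  apply/seteqP; split => s /=; first by move=> Bs j _; case: eqP => // ->.
  by move/(_ i (ltnSn i)); rewrite eqxx.
apply: smallest_sub; first exact: sigma_algebra_measurable.
by move=> A [N [B [mB ->]]]; exact: measurable_finite_cylinder.
Qed.

Lemma finite_cylindersI : setI_closed finite_cylinders.
Proof.
move=> _ _ [N [B [mB ->]]] [M [C [mC ->]]].
exists (maxn N M), (fun i => (if (i < N)%N then B i else setT) `&`
  (if (i < M)%N then C i else setT)); split.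
  by move=> i; apply: measurableI; case: ifP.
apply/seteqP; split => s /=.
  by case=> sB sC i _; split; case: ifP => // ?; [exact: sB|exact: sC].
move=> sBC; split => i iN.
  by have [] := sBC i (leq_trans iN (leq_maxl _ _)); rewrite iN.
by have [_] := sBC i (leq_trans iN (leq_maxr _ _)); rewrite iN.
Qed.

Lemma measurable_fun_sequence d' (T : measurableType d') (g : T -> nat -> S) :
  (forall i, measurable_fun setT (fun w => g w i)) ->
  measurable_fun setT (g : T -> sequence_space S).
Proof.
move=> mg; apply: (measurability (@cylinders _ S : set (set (sequence_space
  S)))) => //.
move=> _ [A [i [B [mB ->]]] <-].
exact: (mg i measurableT B mB).
Qed.

End sequence_space_cylinders.

(** For fixed [E] the sets [A] satisfying the product formula form a lambda-system, so Dynkin's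
    theorem applies. Independence of two sequences follows by extending one side at a time. *)
Lemma independence_extension d (Omega : measurableType d) (R : realType)
    (P : probability Omega R) d' (T : measurableType d') (G : set (set T))
    (f : Omega -> T) (E : set Omega) :
  measurable_fun setT f -> measurable E ->
  @measurable _ T = <<s G >> -> setI_closed G ->
  (forall A, G A -> P (f @^-1` A `&` E) = (P (f @^-1` A) * P E)%E) ->
  forall A, measurable A -> P (f @^-1` A `&` E) = (P (f @^-1` A) * P E)%E.
Proof.
move=> mf mE TG GI GE A; rewrite TG.
have mfE B : measurable B -> measurable (f @^-1` B).
  by move=> mB; rewrite -[X in measurable X]setTI; exact: mf.
apply: (dynkin_induction (P := fun A =>
  P (f @^-1` A `&` E) = (P (f @^-1` A) * P E)%E) TG GI) => //.
- by rewrite preimage_setT setTI probability_setT mul1e.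
- move=> B mB BE; rewrite preimage_setC probability_setC; last exact: mfE.
  rewrite setIC -setDE measureD//; last 2 first.
  + exact: mfE.
  + by rewrite (le_lt_trans (probability_le1 _ _))// ltry.
  rewrite (setIC E); transitivity (P E - P (f @^-1` B) * P E)%E.
    by congr (_ - _)%E; exact: BE.
  by rewrite muleBl ?mul1e// ?fin_num_measure// fin_num_adde_defr.
- move=> F mF tF FE; rewrite preimage_bigcup setI_bigcupl.
  rewrite measure_bigcup//; last 2 first.
  + by move=> k _; apply: measurableI => //; exact: mfE.
  + apply/trivIsetP => i j _ _ ij; rewrite setIACA -preimage_setI.
    by move/trivIsetP : tF => ->//; rewrite preimage_set0 set0I.
  rewrite measure_bigcup//; last 2 first.
  + by move=> k _; exact: mfE.
  + apply/trivIsetP => i j _ _ ij; rewrite -preimage_setI.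
    by move/trivIsetP : tF => ->//; rewrite preimage_set0.
  transitivity (\sum_(k <oo | k \in [set: nat]) (P (f @^-1` F k) * P E))%E.
    by apply: eq_eseriesr => k _; exact: FE.
  rewrite -(fineK (fin_num_measure P _ mE)) muleC -nneseriesZl//.
  by apply: eq_eseriesr => k _; rewrite muleC.
Qed.

Section iid_family.
Context (R : realType) d (Omega : measurableType d) (P : probability Omega R).
Context (I : choiceType) d' (S : measurableType d') (Z : I -> Omega -> S).
Hypothesis iidZ : iid P Z.

(** Pasts, coupled pasts and their interleaving are all selections from one iid family along
    injective index maps; one statement on laws and one on independence cover them. *)
Definition reindexed (s : nat -> I) (w : Omega) : sequence_space S :=
  fun i => Z (s i) w.

Lemma measurable_reindexed s : measurable_fun setT (reindexed s).
Proof. by apply: measurable_fun_sequence => i; case: iidZ => mZ _ _;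
  exact: mZ. Qed.

(** Independence is stated with sets indexed by [I], cylinders with sets indexed by positions. For
    injective [s] this is [B i] at [k = s i] and the whole space off the range of [s]. *)
Let pull (s : nat -> I) (B : nat -> set S) (k : I) : set S :=
  [set x | forall i, s i = k -> B i x].

Let pullE s B i : injective s -> pull s B (s i) = B i.
Proof.
move=> injs; apply/seteqP; split => x /=; first exact.
by move=> Bx j /injs ->.
Qed.

Let pull_notin s B k : (forall i, s i <> k) -> pull s B k = setT.
Proof. by move=> sk; apply/seteqP; split => // x _ i /sk. Qed.

Let measurable_pull s B k : injective s -> (forall i, measurable (B i)) ->
  measurable (pull s B k).
Proof.
move=> injs mB; have [[i <-]|nk] := pselect (exists i, s i = k).
  by rewrite pullE.
by rewrite pull_notin// => i ik; apply: nk; exists i.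
Qed.

Let prob_cylinder s B N : injective s -> (forall i, measurable (B i)) ->
  P (reindexed s @^-1` finite_cylinder N B) =
  (\prod_(i <- iota 0 N) P (Z (s i) @^-1` B i))%E.
Proof.
move=> injs mB; have [mZ indZ _] := iidZ.
have := indZ (map s (iota 0 N)) (pull s B).
rewrite map_inj_uniq// iota_uniq => /(_ isT (fun k =>
  measurable_pull _ injs mB)).
rewrite big_map; under eq_bigr do rewrite pullE//.
move=> <-; congr (P _); apply/seteqP; split => w /=.
  move=> Bw _ /= /mapP[i iN ->]; rewrite pullE//; apply: Bw.
  by move: iN; rewrite mem_iota.
move=> Bw i iN; have := Bw (s i); rewrite pullE//; apply.
by apply: map_f; rewrite mem_iota.
Qed.

(** Both laws give a finite cylinder the product of its marginals, and these do not depend on the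
    indices. *)
Lemma distribution_reindexed s t A : injective s -> injective t ->
  measurable A -> P (reindexed s @^-1` A) = P (reindexed t @^-1` A).
Proof.
move=> injs injt mA; have [_ _ idZ] := iidZ.
apply: (measure_unique (@finite_cylinders _ S) (fun=> setT) _ _ _ _
  (distribution P (mfun_of (measurable_reindexed s)))
  (distribution P (mfun_of (measurable_reindexed t)))) => //.
- exact: finite_cylinders_gen.
- exact: finite_cylindersI.
- move=> _; exists 0%N, (fun=> setT); split => //.
  by apply/seteqP; split.
- by rewrite bigcup_const.
- move=> _ [N [B [mB ->]]]; rewrite /distribution /pushforward/=.
  rewrite [LHS]prob_cylinder// [RHS]prob_cylinder//.
  by apply: eq_bigr => i _; exact: idZ.
- by move=> _; rewrite (le_lt_trans (probability_le1 _ _))// ltry.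
Qed.

Lemma independent_reindexed s t A B : injective s -> injective t ->
  (forall i j, s i <> t j) -> measurable A -> measurable B ->
  P (reindexed s @^-1` A `&` reindexed t @^-1` B) =
  (P (reindexed s @^-1` A) * P (reindexed t @^-1` B))%E.
Proof.
move=> injs injt st mA mB; have [mZ indZ _] := iidZ.
have mpre r D : measurable D -> measurable (reindexed r @^-1` D).
  by move=> mD; rewrite -[X in measurable X]setTI; exact: measurable_reindexed.
apply: (independence_extension (measurable_reindexed s) _
  (@finite_cylinders_gen _ S) (@finite_cylindersI _ S)) mA => //.
  exact: mpre.
move=> _ [N [C [mC ->]]]; rewrite setIC muleC.
apply: (independence_extension (measurable_reindexed t) _
  (@finite_cylinders_gen _ S) (@finite_cylindersI _ S)) mB => //.
  by apply: mpre; exact: measurable_finite_cylinder.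
move=> _ [M [D [mD ->]]]; rewrite setIC muleC !prob_cylinder//.
(* The ranges of [s] and [t] are disjoint, so one of the two constraints is always trivial, and
   mutual independence over the concatenated index list splits into two products. *)
pose CD k := pull s C k `&` pull t D k.
have CDs i : CD (s i) = C i.
  by rewrite /CD pullE// pull_notin ?setIT// => j tj; apply: (st i j).
have CDt i : CD (t i) = D i.
  by rewrite /CD pullE// pull_notin ?setTI// => j; exact: st.
have := indZ (map s (iota 0 N) ++ map t (iota 0 M)) CD.
rewrite cat_uniq !map_inj_uniq// !iota_uniq andbT/=.
have -> : ~~ has (mem [seq s i | i <- iota 0 N]) [seq t i | i <- iota 0 M].
  by apply/hasPn => _ /mapP[j _ ->]; apply/negP => /mapP[i _] /esym; exact: st.
move=> /(_ isT) H; rewrite big_cat !big_map/= in H.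
under eq_bigr do rewrite -CDs.
under [X in (_ * X)%E]eq_bigr do rewrite -CDt.
rewrite -H; last by move=> k; apply: measurableI; exact: measurable_pull.
congr (P _); apply/seteqP; split => w /=.
  case=> Cw Dw k /=; rewrite mem_cat => /orP[] /mapP[i];
    rewrite mem_iota => iN ->.
    by rewrite CDs; exact: Cw.
  by rewrite CDt; exact: Dw.
move=> CDw; split => i iN.
  by rewrite -CDs; apply: CDw; rewrite /= mem_cat map_f// mem_iota.
by rewrite -CDt; apply: CDw; rewrite /= mem_cat orbC map_f// mem_iota.
Qed.

End iid_family.

(** * Expectations and fourth moments *)

Section expectations.
Context (R : realType) d (Omega : measurableType d) (P : probability Omega R).
Implicit Types f g : Omega -> R.

Definition rv_integrable f : Prop := P.-integrable setT (EFin \o f).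

Definition Ex f : R := \int[P]_w f w.

Lemma rv_integrable_measurable f : rv_integrable f -> measurable_fun setT f.
Proof. by move/measurable_int/measurable_EFinP. Qed.

Lemma ExE f : rv_integrable f -> (\int[P]_w (f w)%:E = (Ex f)%:E)%E.
Proof. by move=> fi; rewrite /Ex /Rintegral fineK// integrable_fin_num. Qed.

Lemma rv_integrable_le f g : measurable_fun setT f -> rv_integrable g ->
  (forall w, `|f w| <= g w) -> rv_integrable f.
Proof.
move=> mf ig fg; apply: le_integrable ig => //; first exact/measurable_EFinP.
by move=> w _; rewrite lee_fin (le_trans (fg w))// ler_norm.
Qed.

Lemma ge0_rv_integrable f M : measurable_fun setT f -> (forall w, 0 <= f w) ->
  (\int[P]_w (f w)%:E <= M%:E)%E -> rv_integrable f /\ Ex f <= M.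
Proof.
move=> mf f0 fM; have fi : rv_integrable f.
  apply/integrableP; split; first exact/measurable_EFinP.
  under eq_integral do rewrite /= ger0_norm//.
  by rewrite (le_lt_trans fM)// ltry.
by split => //; rewrite -lee_fin -ExE.
Qed.

Lemma rv_integrableD f g : rv_integrable f -> rv_integrable g ->
  rv_integrable (fun w => f w + g w).
Proof. by move=> fi gi; exact: (integrableD measurableT fi gi). Qed.

Lemma ExD f g : rv_integrable f -> rv_integrable g ->
  Ex (fun w => f w + g w) = Ex f + Ex g.
Proof. by move=> fi gi; exact: RintegralD. Qed.

Lemma rv_integrableZ c f : rv_integrable f -> rv_integrable (fun w => c * f w).
Proof. by move=> fi; exact: (integrableZl measurableT c fi). Qed.

Lemma ExZ c f : rv_integrable f -> Ex (fun w => c * f w) = c * Ex f.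
Proof. by move=> fi; exact: RintegralZl. Qed.

Lemma rv_integrable_cst c : rv_integrable (fun=> c).
Proof. exact: (finite_measure_integrable_cst P c). Qed.

Lemma Ex_cst c : Ex (fun=> c) = c.
Proof. by rewrite /Ex Rintegral_cst//
  [X in _ * fine X](probability_setT P) mulr1. Qed.

Lemma rv_integrable_sum (I : eqType) (r : seq I) (F : I -> Omega -> R) :
  (forall i, i \in r -> rv_integrable (F i)) ->
  rv_integrable (fun w => \sum_(i <- r) F i w) /\
  Ex (fun w => \sum_(i <- r) F i w) = \sum_(i <- r) Ex (F i).
Proof.
elim: r => [|i r IH] Fi.
  have -> : (fun w => \sum_(i <- [::]) F i w) = cst 0.
    by apply/funext => w; rewrite big_nil.
  by rewrite big_nil; split; [exact: rv_integrable_cst|exact: Ex_cst].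
have -> : (fun w => \sum_(j <- i :: r) F j w) =
    (fun w => F i w + \sum_(j <- r) F j w).
  by apply/funext => w; rewrite big_cons.
have [i1 i2] : rv_integrable (fun w => \sum_(j <- r) F j w) /\
    Ex (fun w => \sum_(j <- r) F j w) = \sum_(j <- r) Ex (F j).
  by apply: IH => j jr; apply: Fi; rewrite inE jr orbT.
have Fii : rv_integrable (F i) by apply: Fi; rewrite mem_head.
by split; [exact: rv_integrableD|rewrite ExD// big_cons i2].
Qed.

Lemma le_Ex f g : rv_integrable f -> rv_integrable g ->
  (forall w, f w <= g w) -> Ex f <= Ex g.
Proof. by move=> fi gi fg; apply: le_Rintegral. Qed.

Lemma markov_ineq f c : 0 < c -> rv_integrable f -> (forall w, 0 <= f w) ->
  (P [set w | (c <= f w)%R] <= (Ex f / c)%:E)%E.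
Proof.
move=> c0 fi f0; have mf := rv_integrable_measurable fi.
have mA : measurable [set w | c <= f w] by exact: measurable_le.
have h : (c%:E * P [set w | (c <= f w)%R] <= (Ex f)%:E)%E.
  have -> : P [set w | c <= f w] = (\int[P]_w (\1_[set w | c <= f w] w)%:E)%E.
    by rewrite integral_indic// setIT.
  rewrite -ExE// -ge0_integralZl//; last 2 first.
  - exact/measurable_EFinP/measurable_indic.
  - by rewrite lee_fin ltW.
  apply: ge0_le_integral => //.
  - by move=> w _; rewrite -EFinM lee_fin mulr_ge0// ltW.
  - apply: emeasurable_funM => //; exact/measurable_EFinP/measurable_indic.
  - exact/measurable_EFinP.
  move=> w _; rewrite -EFinM lee_fin indicE.
  case: (boolP (w \in _)) => [|_]; last by rewrite mulr0.
  by rewrite inE/= mulr1.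
rewrite -(fineK (fin_num_measure P _ mA)) lee_fin ler_pdivlMr// mulrC -lee_fin.
by rewrite EFinM fineK// fin_num_measure.
Qed.

(* The [L^4] norm of [f] is at most [al], stated without roots. *)
Definition L4_le f (al : R) : Prop :=
  measurable_fun setT f /\ (\int[P]_w (`|f w| ^+ 4)%:E <= (al ^+ 4)%:E)%E.

(* Hoelder's inequality with four exponents 4: after normalization it is the
   integral of [x y z t <= (x^4 + y^4 + z^4 + t^4) / 4]. *)
Lemma hoelder4 (f1 f2 f3 f4 : Omega -> R) (a1 a2 a3 a4 : R) :
  0 < a1 -> 0 < a2 -> 0 < a3 -> 0 < a4 ->
  L4_le f1 a1 -> L4_le f2 a2 -> L4_le f3 a3 -> L4_le f4 a4 ->
  rv_integrable (fun w => `|f1 w| * `|f2 w| * (`|f3 w| * `|f4 w|)) /\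
  Ex (fun w => `|f1 w| * `|f2 w| * (`|f3 w| * `|f4 w|)) <=
    a1 * a2 * (a3 * a4).
Proof.
move=> a10 a20 a30 a40 [m1 h1] [m2 h2] [m3 h3] [m4 h4].
have L4i f a : 0 < a -> measurable_fun setT f ->
    (\int[P]_w (`|f w| ^+ 4)%:E <= (a ^+ 4)%:E)%E ->
    rv_integrable (fun w => a ^- 4 * `|f w| ^+ 4) /\
    Ex (fun w => a ^- 4 * `|f w| ^+ 4) <= 1.
  move=> a0 mf fa.
  have [|i e] := ge0_rv_integrable _ (fun w =>
    exprn_ge0 4 (normr_ge0 (f w))) fa.
    by apply: measurable_funX; exact: measurableT_comp.
  split; first exact: rv_integrableZ.
  by rewrite ExZ// mulrC ler_pdivrMr ?mul1r// exprn_gt0.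
have [i1 e1] := L4i _ _ a10 m1 h1; have [i2 e2] := L4i _ _ a20 m2 h2.
have [i3 e3] := L4i _ _ a30 m3 h3; have [i4 e4] := L4i _ _ a40 m4 h4.
set k := a1 * a2 * (a3 * a4); have k0 : 0 < k by rewrite !mulr_gt0.
pose G w := (k / 4) * ((a1 ^- 4 * `|f1 w| ^+ 4 + a2 ^- 4 * `|f2 w| ^+ 4) +
                 (a3 ^- 4 * `|f3 w| ^+ 4 + a4 ^- 4 * `|f4 w| ^+ 4)).
have i12 := rv_integrableD i1 i2; have i34 := rv_integrableD i3 i4.
have Gi : rv_integrable G by apply: rv_integrableZ; exact: rv_integrableD.
have amgm (x y z t : R) : x * y * (z * t) <= (x ^+ 4 + y ^+ 4 + (z ^+ 4 + t ^+
  4)) / 4.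
  have q1 := sqr_ge0 (x * y - z * t).
  have q2 := sqr_ge0 (x ^+ 2 - y ^+ 2); have q3 := sqr_ge0 (z ^+ 2 - t ^+ 2).
  nra.
have leG w : `|(`|f1 w| * `|f2 w| * (`|f3 w| * `|f4 w|))| <= G w.
  rewrite ger0_norm ?mulr_ge0//.
  have := amgm (`|f1 w| / a1) (`|f2 w| / a2) (`|f3 w| / a3) (`|f4 w| / a4).
  rewrite /G -(ler_pM2l k0) => h; apply: le_trans (le_trans h _).
    rewrite le_eqVlt; apply/orP; left; apply/eqP; rewrite /k; field.
    by rewrite !gt_eqF.
  by rewrite le_eqVlt; apply/orP; left; apply/eqP; field; rewrite !gt_eqF.
have fi : rv_integrable (fun w => `|f1 w| * `|f2 w| * (`|f3 w| * `|f4 w|)).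
  apply: rv_integrable_le leG => //.
  by do ?[apply: measurable_funM]; exact: measurableT_comp.
split => //; have : Ex (fun w =>
  `|f1 w| * `|f2 w| * (`|f3 w| * `|f4 w|)) <= Ex G.
  by apply: le_Ex => // w; rewrite (le_trans (ler_norm _)).
move/le_trans; apply; rewrite /G ExZ; last exact: rv_integrableD.
rewrite ExD// !ExD//; have k4 : 0 <= k / 4 by rewrite divr_ge0// ltW.
rewrite (@le_trans _ _ (k / 4 * (1 + 1 + (1 + 1))))//.
  by rewrite ler_wpM2l// !lerD.
by rewrite le_eqVlt; apply/orP; left; apply/eqP; field.
Qed.

End expectations.

Lemma integral_of_law (R : realType) d (Omega : measurableType d)
    (P : probability Omega R) d' (T : measurableType d') (u : Omega -> T)
    (mu : measurable_fun setT u) (g : T -> \bar R) :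
  measurable_fun setT g ->
  (\int[distribution P (mfun_of mu)]_t g t = \int[P]_w g (u w))%E.
Proof.
move=> mg; rewrite [LHS]integralE [RHS]integralE; congr (_ - _)%E.
- rewrite (ge0_integral_distribution (mfun_of mu) (measurable_funepos mg))//.
  by apply: eq_integral => w _; rewrite /= !funeposE.
- rewrite (ge0_integral_distribution (mfun_of mu) (measurable_funeneg mg))//.
  by apply: eq_integral => w _; rewrite /= !funenegE.
Qed.

Lemma integral_same_law (R : realType) d (Omega : measurableType d)
    (P : probability Omega R) d' (T : measurableType d') (u1 u2 : Omega -> T)
    (g : T -> \bar R) :
  measurable_fun setT u1 -> measurable_fun setT u2 ->
  (forall A, measurable A -> P (u1 @^-1` A) = P (u2 @^-1` A)) ->
  measurable_fun setT g ->
  (\int[P]_w g (u1 w) = \int[P]_w g (u2 w))%E.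
Proof.
move=> m1 m2 u12 mg; rewrite -(integral_of_law P m1)//
  -(integral_of_law P m2)//.
by apply: eq_measure_integral => A mA _; exact: u12.
Qed.

(** * Covariances under coupling *)

(** Independence makes the joint law the product of the marginal laws, so Fubini integrates [u1] out
    first; [phi t] is the value of that inner integral. *)
Lemma integral_independent (R : realType) d (Omega : measurableType d)
    (P : probability Omega R) d1 d2 (T1 : measurableType d1)
    (T2 : measurableType d2) (u1 : Omega -> T1) (u2 : Omega -> T2)
    (F : T1 * T2 -> \bar R) (phi : T2 -> \bar R) :
  measurable_fun setT u1 -> measurable_fun setT u2 ->
  (forall A B, measurable A -> measurable B ->
    P (u1 @^-1` A `&` u2 @^-1` B) = (P (u1 @^-1` A) * P (u2 @^-1` B))%E) ->
  measurable_fun setT F -> measurable_fun setT phi ->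
  P.-integrable setT (fun w => F (u1 w, u2 w)) ->
  (forall t, \int[P]_w F (u1 w, t) = phi t)%E ->
  (\int[P]_w F (u1 w, u2 w) = \int[P]_w phi (u2 w))%E.
Proof.
move=> m1 m2 ind mF mphi Fi phiE.
have mJ : measurable_fun setT (fun w =>
  (u1 w, u2 w)) by exact: measurable_fun_pair.
pose mu1 := distribution P (mfun_of m1);
  pose mu2 := distribution P (mfun_of m2).
have prodE A : measurable A ->
    (mu1 \x mu2)%E A = pushforward P (fun w => (u1 w, u2 w)) A.
  move=> mA; apply: (product_measure_unique (m' := distribution P (mfun_of
    mJ))) mA.
  move=> A1 A2 mA1 mA2; exact: ind.
have iprod : (mu1 \x mu2)%E.-integrable setT F.
  have /integrableP[_ fin] := Fi; apply/integrableP; split => //.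
  rewrite (eq_measure_integral (distribution P (mfun_of mJ))); last first.
    by move=> A mA _; exact: prodE.
  rewrite (ge0_integral_distribution (mfun_of mJ))//.
  exact: measurableT_comp.
have /= E := integral21_prod_meas1 iprod.
rewrite (eq_measure_integral (distribution P (mfun_of mJ))) in E; last first.
  by move=> A mA _; exact: prodE.
rewrite (integral_of_law P mJ mF) in E.
rewrite -[LHS]E -(integral_of_law P m2 mphi).
apply: eq_integral => t _; rewrite /fubini_G -phiE.
apply: (integral_of_law P m1 (g := fun s => F (s, t))).
exact: (measurable_fun_pair1 t mF).
Qed.

(* In the average of [q (p k) (p l)], [p l] is replaced with its copy
   [c (l - k) l] independent of [p k], at a cost that is summable in [l - k];
   [th] is the mean of [q] under independence. *)
Section coupled_variance.
Context (R : realType) d (Omega : measurableType d) (P : probability Omega R).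
Context d' (T : measurableType d') (H1 H2 : hilbertType R).
Hypotheses (sepH1 : separable H1) (sepH2 : separable H2).
Variables (p : nat -> Omega -> T) (c : nat -> nat -> Omega -> T).
Variables (a : T -> H1) (b : T -> H2).
Variables (al be Ra Rb th : R) (r s : nat -> R) (phi : T -> R).
Hypotheses (ma : weakly_measurable a) (mb : weakly_measurable b).
Hypothesis mphi : measurable_fun setT phi.
Hypothesis mp : forall n, measurable_fun setT (p n).
Hypothesis mc : forall m n, measurable_fun setT (c m n).
Hypothesis indep : forall k l, (0 < k)%N -> (k < l)%N ->
  forall A B, measurable A -> measurable B ->
  P (p k @^-1` A `&` c (l - k) l @^-1` B) =
  (P (p k @^-1` A) * P (c (l - k) l @^-1` B))%E.
Hypotheses (al0 : 0 < al) (be0 : 0 < be).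
Hypotheses (r0 : forall m, 0 < r m) (s0 : forall m, 0 < s m).
Hypothesis L4a : forall n, (0 < n)%N -> L4_le P (fun w => `|a (p n w)|) al.
Hypothesis L4b : forall n, (0 < n)%N -> L4_le P (fun w => `|b (p n w)|) be.
Hypothesis L4ac : forall m n, (0 < m)%N -> (0 < n)%N ->
  L4_le P (fun w => `|a (c m n w)|) al.
Hypothesis L4bc : forall m n, (0 < m)%N -> (0 < n)%N ->
  L4_le P (fun w => `|b (c m n w)|) be.
Hypothesis L4da : forall m n, (0 < m)%N -> (0 < n)%N ->
  L4_le P (fun w => `|a (p n w) - a (c m n w)|) (r m).
Hypothesis L4db : forall m n, (0 < m)%N -> (0 < n)%N ->
  L4_le P (fun w => `|b (p n w) - b (c m n w)|) (s m).
Hypothesis sumr : forall N, \sum_(1 <= h < N) r h <= Ra.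
Hypothesis sums : forall N, \sum_(1 <= h < N) s h <= Rb.
Hypothesis phiE : forall k t, (0 < k)%N ->
  (\int[P]_w (inner (a (p k w)) (a t) * inner (b (p k w)) (b t))%:E = (phi
    t)%:E)%E.
Hypothesis thE : forall m n, (0 < m)%N -> (0 < n)%N ->
  (\int[P]_w (phi (c m n w))%:E = th%:E)%E.
Hypothesis th0 : 0 <= th.

Let q (t1 t2 : T) : R := inner (a t1) (a t2) * inner (b t1) (b t2).

Let mq (u1 u2 : Omega -> T) : measurable_fun setT u1 -> measurable_fun setT u2
  ->
  measurable_fun setT (fun w => q (u1 w) (u2 w)).
Proof.
move=> m1 m2; apply: measurable_funM; apply: measurable_fun_inner => //;
  exact: weakly_measurable_comp.
Qed.

Let q_le t1 t2 : `|q t1 t2| <= `|a t1| * `|a t2| * (`|b t1| * `|b t2|).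
Proof. by rewrite normrM ler_pM// cauchy_schwarz. Qed.

Let q_integrable (u1 u2 : Omega -> T) :
  measurable_fun setT u1 -> measurable_fun setT u2 ->
  L4_le P (fun w => `|a (u1 w)|) al -> L4_le P (fun w => `|a (u2 w)|) al ->
  L4_le P (fun w => `|b (u1 w)|) be -> L4_le P (fun w => `|b (u2 w)|) be ->
  rv_integrable P (fun w => q (u1 w) (u2 w)) /\
  Ex P (fun w => q (u1 w) (u2 w)) <= al * al * (be * be).
Proof.
move=> m1 m2 a1 a2 b1 b2.
have [i e] := hoelder4 al0 al0 be0 be0 a1 a2 b1 b2.
have qi : rv_integrable P (fun w => q (u1 w) (u2 w)).
  by apply: (rv_integrable_le _ i) => [|w]; [exact: mq|rewrite !normr_id q_le].
split => //; apply: le_trans e; apply: le_Ex => // w.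
by rewrite !normr_id (le_trans (ler_norm _))// q_le.
Qed.

Let dev h := al * be * (r h * be + al * s h).

Let dev0 h : 0 <= dev h.
Proof.
by rewrite /dev !(mulr_ge0, addr_ge0)// ltW.
Qed.

Lemma q_coupling k l : (0 < k)%N -> (k < l)%N ->
  rv_integrable P (fun w => q (p k w) (p l w)) /\
  Ex P (fun w => q (p k w) (p l w)) <= th + dev (l - k).
Proof.
move=> k0 kl; set h := (l - k)%N.
have h0 : (0 < h)%N by rewrite subn_gt0.
have l0 : (0 < l)%N by exact: ltn_trans kl.
have [pi _] := q_integrable (mp k) (mp l) (L4a k0) (L4a l0) (L4b k0) (L4b l0).
have [ci _] := q_integrable (mp k) (mc h l) (L4a k0) (L4ac h0 l0) (L4b k0)
  (L4bc h0 l0).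
split => //.
have cE : Ex P (fun w => q (p k w) (c h l w)) = th.
  apply: (congr1 fine (x := (\int[P]_w (q (p k w) (c h l w))%:E)%E) (y :=
    th%:E)).
  rewrite -(thE h0 l0);
    apply: (integral_independent (F := fun t => (q t.1 t.2)%:E)
    (phi := fun t => (phi t)%:E)) => //.
  - by move=> A B mA mB; apply: indep.
  - apply/measurable_EFinP; apply: measurable_funM;
      apply: measurable_fun_inner => //;
      apply: weakly_measurable_comp => //;
        exact: measurable_fst || exact: measurable_snd.
  - exact/measurable_EFinP.
  - by move=> t; exact: phiE.
rewrite -lerBlDl -[in leLHS]cE -mulN1r -ExZ// -ExD//;
  last exact: rv_integrableZ.
have [i1 e1] := hoelder4 al0 (r0 h) be0 be0 (L4a k0) (L4da h0 l0) (L4b k0) (L4b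
  l0).
have [i2 e2] := hoelder4 al0 al0 be0 (s0 h) (L4a k0) (L4ac h0 l0) (L4b k0)
  (L4db h0 l0).
apply: (@le_trans _ _ (Ex P (fun w =>
   `| `|a (p k w)| | * `| `|a (p l w) - a (c h l w)| | *
     (`| `|b (p k w)| | * `| `|b (p l w)| |) +
   `| `|a (p k w)| | * `| `|a (c h l w)| | *
     (`| `|b (p k w)| | * `| `|b (p l w) - b (c h l w)| |)))).
  apply: le_Ex; [|exact: rv_integrableD|].
    by apply: rv_integrableD => //; exact: rv_integrableZ.
  move=> w; rewrite !normr_id mulN1r.
  (* The copy is exchanged in one inner product at a time, so that each term contains a single
     coupling difference. The Hoelder bounds [e1] and [e2] of the two terms add up to [dev h]. *)
  have -> : q (p k w) (p l w) - q (p k w) (c h l w) =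
     inner (a (p k w)) (a (p l w) - a (c h l w)) * inner (b (p k w)) (b (p l
       w)) +
     inner (a (p k w)) (a (c h l w)) * inner (b (p k w)) (b (p l w) - b (c h l
       w)).
    by rewrite /q !innerBr; ring.
  rewrite (le_trans (ler_norm _))// (le_trans (ler_normD _ _))//.
  by rewrite !normrM lerD// ler_pM// cauchy_schwarz.
rewrite ExD//; apply: (le_trans (lerD e1 e2)).
by rewrite /dev le_eqVlt; apply/orP; left; apply/eqP; ring.
Qed.

Let dist k l := ((l - k) + (k - l))%N.
(** On the diagonal there is nothing to couple and only the moment bound is available; as [th >= 0],
    it too has the form [th + bnd 0]. *)
Let bnd h := if h is 0 then al * al * (be * be) else dev h.

Let q_pair k l : (0 < k)%N -> (0 < l)%N ->
  rv_integrable P (fun w => q (p k w) (p l w)) /\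
  Ex P (fun w => q (p k w) (p l w)) <= th + bnd (dist k l).
Proof.
move=> k0 l0; rewrite /dist; have [kl|lk|<-] := ltngtP k l.
- have [i e] := q_coupling k0 kl; split => //.
  have -> : (k - l)%N = 0%N by apply/eqP; rewrite subn_eq0 ltnW.
  rewrite addn0 (le_trans e)// lerD2l /bnd.
  by move: kl; rewrite -subn_gt0; case: (l - k)%N.
- have [i e] := q_coupling l0 lk.
  have qC : (fun w => q (p k w) (p l w)) = (fun w => q (p l w) (p k w)).
    by apply/funext => w; rewrite /q innerC (innerC (b _)).
  rewrite qC; split => //.
  have -> : (l - k)%N = 0%N by apply/eqP; rewrite subn_eq0 ltnW.
  rewrite add0n (le_trans e)// lerD2l /bnd.
  by move: lk; rewrite -subn_gt0; case: (k - l)%N.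
- have [i e] := q_integrable (mp k) (mp k) (L4a k0) (L4a k0) (L4b k0) (L4b k0).
  split => //; rewrite subnn addn0 (le_trans e)//= lerDr.
  by [].
Qed.

Let U := al * al * (be * be) + al * be * (Ra * be + al * Rb).

Let bnd0 h : 0 <= bnd h.
Proof. by case: h => [|h]; rewrite /bnd ?dev0// !mulr_ge0// ltW. Qed.

Let sum_bnd N : \sum_(0 <= h < N) bnd h <= U.
Proof.
have Ra0 : 0 <= Ra by rewrite (le_trans _ (sumr 0))// big_geq.
have Rb0 : 0 <= Rb by rewrite (le_trans _ (sums 0))// big_geq.
have R0 : 0 <= al * be * (Ra * be + al * Rb).
  by rewrite !(mulr_ge0, addr_ge0)// ltW.
case: N => [|N]; first by rewrite big_geq// addr_ge0// !mulr_ge0// ltW.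
rewrite big_ltn// lerD2l.
have -> : \sum_(1 <= h < N.+1) bnd h = \sum_(1 <= h < N.+1) dev h.
  by apply: eq_big_nat => -[].
rewrite -mulr_sumr; apply: ler_wpM2l; first by rewrite mulr_ge0 ?ltW.
rewrite big_split/= -mulr_suml -mulr_sumr; apply: lerD.
  by rewrite ler_wpM2r// ltW.
by rewrite ler_wpM2l// ltW.
Qed.

Lemma coupled_variance n :
  rv_integrable P (fun w => \sum_(1 <= k < n.+1) \sum_(1 <= l < n.+1)
    inner (a (p k w)) (a (p l w)) * inner (b (p k w)) (b (p l w))) /\
  Ex P (fun w => \sum_(1 <= k < n.+1) \sum_(1 <= l < n.+1)
    inner (a (p k w)) (a (p l w)) * inner (b (p k w)) (b (p l w))) <=
  n%:R ^+ 2 * th + n%:R * (2 * U).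
Proof.
have row k : (0 < k <= n)%N ->
    rv_integrable P (fun w => \sum_(1 <= l < n.+1) q (p k w) (p l w)) /\
    Ex P (fun w => \sum_(1 <= l < n.+1) q (p k w) (p l w)) <= n%:R * th + 2 * U.
  move=> /andP[k0 kn].
  have [|i ->] := @rv_integrable_sum _ _ _ P nat (index_iota 1 n.+1)
    (fun l w => q (p k w) (p l w)).
    by move=> l; rewrite mem_index_iota => /andP[l0 _]; have [] := q_pair k0 l0.
  split => //.
  apply: (@le_trans _ _ (\sum_(1 <= l < n.+1) (th + bnd (dist k l)))).
    rewrite !big_seq; apply: ler_sum => l;
      rewrite mem_index_iota => /andP[l0 _].
    by have [] := q_pair k0 l0.
  rewrite big_split/= sumr_const_nat subn1/= mulr_natl lerD2l.
  (* Each distance to [k] occurs at most once on either side of [k], so each part is bounded by [U].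
     The upper part starts at distance 1, and the non-negative [bnd 0] is added to it to match
     [sum_bnd]. *)
  rewrite (@big_cat_nat _ _ _ k.+1)//= mulr_natl mulr2n lerD//.
    apply: le_trans (sum_bnd k); rewrite big_nat_rev/= big_add1/=.
    rewrite le_eqVlt; apply/orP; left; apply/eqP;
      apply: eq_big_nat => h /andP[_ hk].
    rewrite /dist; congr bnd; rewrite addnS addnC -addSn subSS.
    by lia.
  apply: le_trans (sum_bnd (n - k).+1).
  rewrite [leRHS]big_ltn// (big_addn 0 _ k.+1) big_add1/= subSS.
  rewrite -[leLHS]add0r lerD //; first exact: (bnd0 0).
  rewrite le_eqVlt; apply/orP; left; apply/eqP; apply: eq_big_nat => h _.
  by rewrite /dist; have -> : (h + k.+1 - k + (k - (h + k.+1)) = h.+1)%N by lia.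
have [|i ->] := @rv_integrable_sum _ _ _ P nat (index_iota 1 n.+1)
    (fun k w => \sum_(1 <= l < n.+1) q (p k w) (p l w)).
  by move=> k; rewrite mem_index_iota ltnS => /row[].
split => //.
apply: (@le_trans _ _ (\sum_(1 <= k < n.+1) (n%:R * th + 2 * U))).
  rewrite !big_seq; apply: ler_sum => k; rewrite mem_index_iota ltnS => /row[].
  by [].
rewrite sumr_const_nat subn1/= -mulr_natl le_eqVlt; apply/orP; left; apply/eqP;
  ring.
Qed.

End coupled_variance.

(** * Fourth moments and laws of the pasts and coupled pasts *)

Section L4_norms.
Context (R : realType) d (Omega : measurableType d) (P : probability Omega R).

Lemma L4_le_scale (f g : Omega -> R) (k al : R) : 0 <= k -> 0 <= al ->
  measurable_fun setT g -> (forall w, `|g w| <= k * `|f w|) ->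
  L4_le P f al -> L4_le P g (k * al).
Proof.
move=> k0 al0 mg gf [mf fa]; split => //.
have mX4 (h : Omega -> R) : measurable_fun setT h ->
    measurable_fun setT (fun w => (`|h w| ^+ 4)%:E).
  by move=> mh; apply/measurable_EFinP/measurable_funX; exact: measurableT_comp.
rewrite exprMn EFinM (@le_trans _ _ ((k ^+ 4)%:E * \int[P]_w (`|f w| ^+
  4)%:E)%E)//; last first.
  by rewrite lee_wpmul2l// lee_fin exprn_ge0.
rewrite -ge0_integralZl//; last 2 first.
- exact: mX4.
- by rewrite lee_fin exprn_ge0.
apply: ge0_le_integral => //.
- exact: (mX4 g mg).
- by apply: emeasurable_funM => //; exact: (mX4 f mf).
by move=> w _; rewrite -EFinM lee_fin -exprMn lerXn2r ?nnegrE ?mulr_ge0.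
Qed.

Lemma nu_ge0 (H : normedModType R) q (Z : Omega -> H) : (0 <= nu P q Z)%E.
Proof. exact: Lnorm_ge0. Qed.

Lemma nu_L4_le (H : normedModType R) (Z : Omega -> H) (al : R) :
  measurable_fun setT (fun w => `|Z w|) -> (nu P 4 Z <= al%:E)%E ->
  L4_le P (fun w => `|Z w|) al.
Proof.
move=> mZ Zal; split => //.
have nu4 : (\int[P]_w (`| `|Z w| | ^+ 4)%:E = nu P 4 Z `^ 4)%E.
  rewrite /nu poweR_Lnorm//; apply: eq_integral => w _.
  by rewrite abse_EFin poweR_EFin powR_mulrn.
have al0 : 0 <= al by rewrite -lee_fin (le_trans _ Zal)// nu_ge0.
rewrite nu4 -[al ^+ 4]powR_mulrn// -poweR_EFin.
by rewrite gt0_ler_poweR// ?in_itv/= ?nu_ge0 ?leey// lee_fin al0.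
Qed.

End L4_norms.

Section innovations_theory.
Context (R : realType) d (Omega : measurableType d) (P : probability Omega R).
Context d' (S : measurableType d') (delta delta' : int -> Omega -> S).
Hypothesis innov : innovations P delta delta'.

Let Z (i : int + int) : Omega -> S :=
  match i with inl k => delta k | inr k => delta' k end.
Let iidZ : iid P Z := innov.

Definition past_seq n : Omega -> sequence_space S := past delta n.

Definition coupled_seq m n : Omega -> sequence_space S :=
  coupled_past delta delta' m n.

Let sp (n i : nat) : int + int := inl (n%:Z - i%:Z).
Let sc (m n i : nat) : int + int :=
  if (i < m)%N then inl (n%:Z - i%:Z) else inr (n%:Z - i%:Z).

Let coupled_seqE m n : coupled_seq m n = reindexed Z (sc m n).
Proof.
apply/funext => w; apply/funext => i.
by rewrite /coupled_seq /coupled_past /reindexed /sc; case: ifP.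
Qed.

Let sp_inj n : injective (sp n).
Proof. by move=> i j [] ij; lia. Qed.

Let sc_inj m n : injective (sc m n).
Proof.
move=> i j; rewrite /sc; case: ifP; case: ifP => _ _ ij //; case: ij => ij; lia.
Qed.

Lemma measurable_past_seq n : measurable_fun setT (past_seq n).
Proof. exact: (measurable_reindexed iidZ (sp n)). Qed.

Lemma measurable_coupled_seq m n : measurable_fun setT (coupled_seq m n).
Proof. by rewrite coupled_seqE; exact: (measurable_reindexed iidZ). Qed.

Lemma past_seq_law k n A : measurable A ->
  P (past_seq n @^-1` A) = P (past_seq k @^-1` A).
Proof. exact: (distribution_reindexed iidZ (@sp_inj n) (@sp_inj k)). Qed.

Lemma coupled_seq_law k m n A : measurable A ->
  P (coupled_seq m n @^-1` A) = P (past_seq k @^-1` A).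
Proof.
rewrite coupled_seqE.
exact: (distribution_reindexed iidZ (@sc_inj m n) (@sp_inj k)).
Qed.

(** With lag [l - k] the coupled past at [l] reads [delta] only at times after [k] and [delta'] from
    time [k] backwards, whereas the past at [k] reads [delta] at times up to [k]. *)
Lemma past_coupled_independent k l : (k < l)%N ->
  forall A B, measurable A -> measurable B ->
  P (past_seq k @^-1` A `&` coupled_seq (l - k) l @^-1` B) =
  (P (past_seq k @^-1` A) * P (coupled_seq (l - k) l @^-1` B))%E.
Proof.
move=> kl A B mA mB; rewrite coupled_seqE.
apply: (independent_reindexed iidZ (@sp_inj k) (@sc_inj _ l)) => //.
by move=> i j; rewrite /sp /sc; case: ifP => // jl [] ij; lia.
Qed.

Lemma past_coupled_stationary m n k (h : sequence_space S * sequence_space S ->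
  \bar R) :
  measurable_fun setT h ->
  (\int[P]_w h (past_seq n w, coupled_seq m n w) =
   \int[P]_w h (past_seq k w, coupled_seq m k w))%E.
Proof.
move=> mh.
(* [W] interleaves delta and delta', so that both arguments of [h] are functions
   of a single sequence whose law is stationary. *)
pose W n := reindexed Z (fun i => if odd i then inr (n%:Z - i./2%:Z)
                                  else inl (n%:Z - i./2%:Z)).
have W_inj j : injective (fun i => if odd i then inr (j%:Z - i./2%:Z)
                                  else inl (j%:Z - i./2%:Z) : int + int).
  by move=> i1 i2; case: ifP; case: ifP => o1 o2 ij //; case: ij => ij; lia.
pose Phi (s : sequence_space S) : sequence_space S * sequence_space S :=
  ((fun i => s i.*2), (fun i => if (i < m)%N then s i.*2 else s i.*2.+1)).
have mPhi : measurable_fun setT Phi.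
  apply: measurable_fun_pair; apply: measurable_fun_sequence => i.
    exact: measurable_coordinate.
  by case: (i < m)%N; exact: measurable_coordinate.
have PhiW j w : (past_seq j w, coupled_seq m j w) = Phi (W j w).
  congr pair; apply/funext => i.
    by rewrite /W /reindexed odd_double doubleK.
  rewrite /coupled_seq /coupled_past /W /reindexed /= odd_double doubleK.
  by rewrite uphalf_double.
under eq_integral do rewrite PhiW.
under [RHS]eq_integral do rewrite PhiW.
apply: (integral_same_law (g := fun s => h (Phi s))).
- exact: (measurable_reindexed iidZ).
- exact: (measurable_reindexed iidZ).
- by move=> A mA; apply: (distribution_reindexed iidZ (@W_inj n) (@W_inj k)).
- exact: measurableT_comp mh mPhi.
Qed.

Section moment_bounds.
Context (H : hilbertType R) (f : (nat -> S) -> H) (X : nat -> Omega -> H).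
Hypothesis sepH : separable H.
Hypothesis approx : Lp_m_approximable_by P 4 delta delta' f X.

Lemma weakly_measurable_representation :
  weakly_measurable (f : sequence_space S -> H).
Proof. by case: approx => mf _ _ _; exact: borel_weakly_measurable. Qed.

Let mf := weakly_measurable_representation.

Lemma representationE n w : (0 < n)%N -> X n w = f (past_seq n w).
Proof. by case: approx => _ XE _ _ n0; exact: XE. Qed.

Let law_L4 (u : Omega -> sequence_space S) al : measurable_fun setT u ->
  (forall A, measurable A -> P (u @^-1` A) = P (past_seq 1 @^-1` A)) ->
  L4_le P (fun w => `|f (past_seq 1 w)|) al -> L4_le P (fun w => `|f (u w)|) al.
Proof.
move=> mu law [m1 h1]; split.
  by apply: measurable_fun_normr => //; exact: (weakly_measurable_comp mu mf).
rewrite (integral_same_law (g := fun s : sequence_space S =>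
  (`| `|f s| | ^+ 4)%:E) mu (measurable_past_seq 1))//.
apply/measurable_EFinP/measurable_funX/measurableT_comp => //.
exact: (measurable_fun_normr sepH mf).
Qed.

Lemma approximable_bounds : exists (al Ra : R) (r : nat -> R),
  [/\ 0 < al, (forall m, 0 < r m), (forall N, \sum_(1 <= h < N) r h <= Ra),
      (forall n, L4_le P (fun w => `|f (past_seq n w)|) al) &
      (forall m n, L4_le P (fun w => `|f (coupled_seq m n w)|) al) /\
      (forall m n, (0 < m)%N ->
        L4_le P (fun w => `|f (past_seq n w) - f (coupled_seq m n w)|) (r m))].
Proof.
have [_ XE nuX nuD] := approx.
pose nd m := nu P 4 (fun w => X m w - f (coupled_past delta delta' m m w)).
have nd0 m : (0 <= nd m)%E by exact: nu_ge0.
(* [hoelder4] divides by the norm bounds, so they must be positive even for degenerate variables. *)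
pose al := fine (nu P 4 (X 1)) + 1.
have al0 : 0 < al by rewrite ltr_wpDl// fine_ge0// nu_ge0.
have L1 : L4_le P (fun w => `|f (past_seq 1 w)|) al.
  have mX1 : measurable_fun setT (fun w => `|X 1%N w|).
    under eq_fun do rewrite representationE//.
    by apply: measurable_fun_normr => //;
      exact: (weakly_measurable_comp (measurable_past_seq 1) mf).
  have : L4_le P (fun w => `|X 1%N w|) al.
    apply: nu_L4_le => //; rewrite -[leLHS]fineK ?lee_fin ?lerDl//.
    by rewrite ge0_fin_numE ?nu_ge0// nuX.
  by under eq_fun do rewrite representationE//.
(* The summable term [2^-m] ensures positivity; its sum accounts for the [+ 2] in the witness for
   [Ra]. *)
pose r m := fine (nd m) + 2^-1 ^+ m.
have sum_nd N : (\sum_(1 <= h < N) nd h <= \sum_(1 <= h <oo) nd h)%E.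
  exact: nneseries_lim_ge.
have nd_fin m : (0 < m)%N -> nd m \is a fin_num.
  move=> m0; rewrite ge0_fin_numE//; apply: le_lt_trans nuD.
  apply: le_trans (sum_nd m.+1); rewrite big_nat_recr//=.
  by rewrite leeDr// sume_ge0.
exists al, (fine (\sum_(1 <= h <oo) nd h)%E + 2), r; split => //.
- by move=> m; rewrite ltr_wpDl ?exprn_gt0// fine_ge0.
- move=> N; rewrite big_split/= lerD//.
    rewrite -lee_fin fineK; last first.
      by rewrite ge0_fin_numE// nneseries_ge0.
    apply: le_trans (sum_nd N); rewrite -sumEFin !big_nat.
    by apply: lee_sum => h /andP[h0 _]; rewrite fineK// nd_fin.
  have h0 : 0 < 2^-1 :> R by rewrite invr_gt0.
  have h1 : `|2^-1| < 1 :> R by rewrite ger0_norm ?ltW// invf_lt1// ltr1n.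
  have := geometric_le_lim N ler01 h0 h1.
  have -> : 1 / (1 - 2^-1) = 2 :> R by field.
  apply: le_trans.
  rewrite /series/=; case: N => [|N]; first by rewrite !big_geq.
  rewrite [leRHS]big_ltn// expr0 mulr1 -[leLHS]add0r lerD//.
  by apply: ler_sum => i _; rewrite mul1r.
- move=> n; apply: law_L4 => //; first exact: measurable_past_seq.
  by move=> A mA; exact: past_seq_law.
split.
  move=> m n; apply: law_L4 => //; first exact: measurable_coupled_seq.
  by move=> A mA; exact: coupled_seq_law.
move=> m n m0.
have md k : measurable_fun setT
    (fun w => `|f (past_seq k w) - f (coupled_seq m k w)|).
  apply: measurable_fun_normr => //; apply: weakly_measurableB.
    exact: (weakly_measurable_comp (measurable_past_seq k) mf).
  exact: (weakly_measurable_comp (measurable_coupled_seq m k) mf).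
have [_ hm] : L4_le P (fun w =>
  `|f (past_seq m w) - f (coupled_seq m m w)|) (r m).
  apply: nu_L4_le => //.
  have -> : (fun w => f (past_seq m w) - f (coupled_seq m m w)) =
      (fun w => X m w - f (coupled_past delta delta' m m w)).
    by apply/funext => w; rewrite representationE.
  by rewrite -[leLHS]fineK ?nd_fin// lee_fin lerDl exprn_ge0.
split => //; apply: le_trans hm.
(* Approximability bounds the coupling error at time [n = m] only; stationarity of the pair carries
   the bound to every [n]. *)
rewrite (past_coupled_stationary m n m (h := fun s =>
  (`| `|f s.1 - f s.2| | ^+ 4)%:E))//.
apply/measurable_EFinP/measurable_funX/measurableT_comp => //.
apply: measurable_fun_normr => //; apply: weakly_measurableB.
  exact: (weakly_measurable_comp measurable_fst mf).
exact: (weakly_measurable_comp measurable_snd mf).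
Qed.

End moment_bounds.

End innovations_theory.

(** * Consistency of the empirical operators *)

Section expectation_of_vectors.
Context (R : realType) d (Omega : measurableType d) (P : probability Omega R).

Lemma is_expectation_inner (H : hilbertType R) (Z : Omega -> H) (e h : H) :
  separable H -> is_expectation P Z e ->
  rv_integrable P (fun w => inner (Z w) h) /\
  Ex P (fun w => inner (Z w) h) = inner e h.
Proof.
move=> sepH [/borel_weakly_measurable mZ Zfin Ze].
have mN := measurable_fun_normr sepH mZ.
have iN : rv_integrable P (fun w => `|Z w|).
  apply/integrableP; split; first exact/measurable_EFinP.
  by under eq_integral do rewrite /= normr_id; rewrite unlock in Zfin.
have iZ : rv_integrable P (fun w => inner (Z w) h).
  apply: (rv_integrable_le _ (rv_integrableZ `|h| iN)) => // w.
  by rewrite mulrC cauchy_schwarz.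
split => //; move: (Ze h); rewrite unlock => /(congr1 fine)/=.
by [].
Qed.

Lemma Ex_EFin (f : Omega -> R) c : rv_integrable P f -> Ex P f = c ->
  (\int[P]_w (f w)%:E = c%:E)%E.
Proof. by move=> fi <-; rewrite ExE. Qed.

End expectation_of_vectors.

Section consistency_bounds.
Context (R : realType) d (Omega : measurableType d) (P : probability Omega R).
Context (H1 H2 : hilbertType R) d' (S : measurableType d').
Variables (delta delta' : int -> Omega -> S).
Variables (f : (nat -> S) -> H1) (g : (nat -> S) -> H2).
Variables (X : nat -> Omega -> H1) (eps : nat -> Omega -> H2).
Hypotheses (sepH1 : separable H1) (sepH2 : separable H2).
Hypothesis innov : innovations P delta delta'.
Hypothesis approxX : Lp_m_approximable_by P 4 delta delta' f X.
Hypothesis approxe : Lp_m_approximable_by P 4 delta delta' g eps.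

Let mp n := measurable_past_seq innov n.
Let mf := weakly_measurable_representation approxX.
Let mg := weakly_measurable_representation approxe.
Let XE n w (n0 : (0 < n)%N) : X n w = f (past_seq delta n w) :=
  representationE approxX w n0.
Let epsE n w (n0 : (0 < n)%N) : eps n w = g (past_seq delta n w) :=
  representationE approxe w n0.

Lemma weakly_measurable_X k : (0 < k)%N -> weakly_measurable (X k).
Proof.
move=> k0 h; under eq_fun do rewrite XE//.
exact: (weakly_measurable_comp (mp k) mf).
Qed.

Lemma X_second_moment : exists2 M : R, 0 <= M & forall k, (0 < k)%N ->
  rv_integrable P (fun w => `|X k w| ^+ 2) /\ Ex P (fun w =>
    `|X k w| ^+ 2) <= M.
Proof.
have [al [_ [_ [al0 _ _ La _]]]] := approximable_bounds innov sepH1 approxX.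
exists (al * al * (1 * 1)) => [|k k0]; first by rewrite !mulr_ge0// ltW.
have L1 : L4_le P (fun=> 1) 1.
  split; first exact: measurable_cst.
  by rewrite normr1 !expr1n integral_cst//
    [X in (_ * X)%E](probability_setT P) mule1.
have := hoelder4 al0 al0 ltr01 ltr01 (La k) (La k) L1 L1.
have -> : (fun w => `| `|f (past_seq delta k w)| | * `| `|f (past_seq delta k
  w)| | *
    (`|1| * `|1|)) = (fun w => `|X k w| ^+ 2).
  by apply/funext => w; rewrite normr_id normr1 !mulr1 -expr2 XE.
by [].
Qed.

(** Orthogonality of [X k] and [eps k], tested at [f t] and [g t], says that the kernel integrates
    to 0 in its first argument. So [phi] and [th] are 0, the double sum has expectation of order
    [n], and [n^-2] turns this into [M / n]. *)
Lemma noise_bound : (forall k, (0 < k)%N -> perp P (X k) (eps k)) ->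
  exists2 M : R, 0 <= M & forall n, (0 < n)%N ->
  let W w := n%:R ^- 2 * \sum_(1 <= k < n.+1) \sum_(1 <= l < n.+1)
    inner (X k w) (X l w) * inner (eps k w) (eps l w) in
  rv_integrable P W /\ Ex P W <= M / n%:R.
Proof.
move=> Xe.
have [al [Ra [r [al0 r0 sr La [Lac Lad]]]]] := approximable_bounds innov sepH1
  approxX.
have [be [Rb [s [be0 s0 ss Lb [Lbc Lbd]]]]] := approximable_bounds innov sepH2
  approxe.
have V := @coupled_variance R d Omega P _ (sequence_space S) H1 H2 sepH1 sepH2
  (past_seq delta) (coupled_seq delta delta') f g al be Ra Rb 0 r s (fun=> 0)
    mf mg
  (measurable_cst _) mp (measurable_coupled_seq innov)
  (fun k l _ => past_coupled_independent innov (k := k) (l := l)) al0 be0 r0 s0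
  (fun n _ => La n) (fun n _ => Lb n) (fun m n _ _ => Lac m n)
  (fun m n _ _ => Lbc m n) (fun m n m0 _ => Lad m n m0) (fun m n m0 _ =>
    Lbd m n m0)
  sr ss.
set U := al * al * (be * be) + al * be * (Ra * be + al * Rb) in V.
have phiE k t : (0 < k)%N -> (\int[P]_w (inner (f (past_seq delta k w)) (f t) *
    inner (g (past_seq delta k w)) (g t))%:E = 0%:E)%E.
  move=> k0; have [i e] := is_expectation_inner (g t) sepH2 (Xe k k0 (f t)).
  rewrite inner0l in e; rewrite -(Ex_EFin i e); apply: eq_integral => w _.
  by rewrite /tensor innerZl XE// epsE.
have thE m n : (0 < m)%N -> (0 < n)%N ->
    (\int[P]_w ((fun=> 0 : R) (coupled_seq delta delta' m n w))%:E = 0%:E)%E.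
  by move=> _ _; rewrite integral0.
have {}V n := V phiE thE (lexx 0) n.
exists (`|2 * U|) => // n n0 W; have [i e] := V n.
have WE : W = (fun w => n%:R ^- 2 * \sum_(1 <= k < n.+1) \sum_(1 <= l < n.+1)
    inner (f (past_seq delta k w)) (f (past_seq delta l w)) *
    inner (g (past_seq delta k w)) (g (past_seq delta l w))).
  apply/funext => w; congr (_ * _); apply: eq_big_nat => k /andP[k0 _].
  by apply: eq_big_nat => l /andP[l0 _]; rewrite !XE// !epsE.
rewrite WE; split; first exact: rv_integrableZ.
have n0' : 0 < n%:R :> R by rewrite ltr0n.
rewrite ExZ//; apply: (le_trans (ler_wpM2l _ e));
  first by rewrite invr_ge0 exprn_ge0.
rewrite mulr0 add0r; have -> : n%:R ^- 2 * (n%:R * (2 * U)) = 2 * U / n%:R.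
  by field; rewrite gt_eqF.
by rewrite ler_wpM2r ?invr_ge0// ler_norm.
Qed.

Section covariance_operator.
Variable C : H1 -> H1.
Hypothesis CE : is_operator_expectation P (fun w =>
  tensor (X 1%N w) (X 1%N w)) C.

(** [CE] concerns [X 1] only; the common law of the pasts transports it to every [k]. *)
Lemma covariance_inner k z h : (0 < k)%N ->
  rv_integrable P (fun w => inner (X k w) z * inner (X k w) h) /\
  Ex P (fun w => inner (X k w) z * inner (X k w) h) = inner (C z) h.
Proof.
move=> k0.
have [i e] := is_expectation_inner h sepH1 (CE z).
pose q (t : sequence_space S) := inner (f t) z * inner (f t) h.
have mq : measurable_fun setT (EFin \o q).
  by apply/measurable_EFinP; apply: measurable_funM; exact: mf.
have lawE (F : sequence_space S -> \bar R) : measurable_fun setT F ->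
    (\int[P]_w F (past_seq delta k w) = \int[P]_w F (past_seq delta 1 w))%E.
  move=> mF; apply: integral_same_law => //;
    try exact: (measurable_past_seq innov).
  by move=> A mA; exact: (past_seq_law innov).
have qk : (fun w => inner (X k w) z * inner (X k w) h) =
    (fun w => q (past_seq delta k w)).
  by apply/funext => w; rewrite XE.
have q1 : (fun w => inner (tensor (X 1%N w) (X 1%N w) z) h) =
    (fun w => q (past_seq delta 1 w)).
  by apply/funext => w; rewrite /tensor innerZl XE.
rewrite q1 in i e; rewrite qk; split.
  have /integrableP[_ fin] := i; apply/integrableP; split.
    exact: (measurableT_comp mq (mp k)).
  by rewrite (lawE (fun t => `|(q t)%:E|)%E)//; exact: measurableT_comp.
by rewrite -e /Ex /Rintegral; congr fine; exact: (lawE (EFin \o q)).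
Qed.

Lemma empirical_covariance_bound z : exists2 M : R, 0 <= M &
  forall n, (0 < n)%N ->
  rv_integrable P (fun w => `|empirical_tensor X X n w z - C z| ^+ 2) /\
  Ex P (fun w => `|empirical_tensor X X n w z - C z| ^+ 2) <= M / n%:R.
Proof.
have [al [Ra [r [al0 r0 sr La [Lac Lad]]]]] := approximable_bounds innov sepH1
  approxX.
(* [|z|^2] is a Lipschitz constant of the map [b] below; adding 1 keeps the resulting moment bounds
   positive when [z = 0]. *)
pose zz := `|z| ^+ 2 + 1.
have zz0 : 0 < zz by rewrite ltr_wpDl// exprn_ge0.
(* With this [b] the kernel of [coupled_variance] sums up to
   [n ^+ 2 * |z| ^+ 2 * |Chat z| ^+ 2]. *)
pose b (t : sequence_space S) := inner (f t) z *: z.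
have b_le t t' : `|b t - b t'| <= zz * `|f t - f t'|.
  rewrite /b -scalerBl -innerBl normrZ.
  rewrite (@le_trans _ _ (`|f t - f t'| * `|z| * `|z|))//.
    by rewrite ler_wpM2r// cauchy_schwarz.
  by rewrite -mulrA -expr2 mulrC ler_wpM2r// lerDl.
have b_le0 t : `|b t| <= zz * `|f t|.
  rewrite /b normrZ (@le_trans _ _ (`|f t| * `|z| * `|z|))//.
    by rewrite ler_wpM2r// cauchy_schwarz.
  by rewrite -mulrA -expr2 mulrC ler_wpM2r// lerDl.
have mb : weakly_measurable b.
  by apply: weakly_measurableZ; [exact: mf|exact: weakly_measurable_cst].
have mbc (u : Omega -> sequence_space S) : measurable_fun setT u ->
    weakly_measurable (b \o u).
  by move=> mu; exact: weakly_measurable_comp.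
have Lb n : L4_le P (fun w => `|b (past_seq delta n w)|) (zz * al).
  apply: (L4_le_scale _ _ _ _ (La n)); rewrite ?ltW//.
    by apply: measurable_fun_normr => //; exact: mbc.
  by move=> w; rewrite !normr_id.
have Lbc m n : L4_le P (fun w =>
  `|b (coupled_seq delta delta' m n w)|) (zz * al).
  apply: (L4_le_scale _ _ _ _ (Lac m n)); rewrite ?ltW//.
    by apply: measurable_fun_normr => //;
      apply: (mbc (coupled_seq delta delta' m n));
        exact: (measurable_coupled_seq innov).
  by move=> w; rewrite !normr_id.
have Lbd m n : (0 < m)%N -> L4_le P (fun w => `|b (past_seq delta n w) -
    b (coupled_seq delta delta' m n w)|) (zz * r m).
  move=> m0; apply: (L4_le_scale _ _ _ _ (Lad m n m0)); rewrite ?ltW//.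
    apply: measurable_fun_normr => //; apply: weakly_measurableB;
      apply: mbc => //.
    exact: (measurable_coupled_seq innov).
  by move=> w; rewrite !normr_id.
have zal0 : 0 < zz * al by rewrite mulr_gt0.
have zr0 m : 0 < zz * r m by rewrite mulr_gt0.
have zsr N : \sum_(1 <= h < N) zz * r h <= zz * Ra.
  by rewrite -mulr_sumr ler_wpM2l// ltW.
pose phi (t : sequence_space S) := inner (f t) (C z) * inner (f t) z * `|z| ^+
  2.
have mphi : measurable_fun setT phi.
  by apply: measurable_funM => //; apply: measurable_funM; exact: mf.
(* After division by [|z|^2] this is [|C z|^2], the part of the second moment of [Chat z] that must
   cancel. *)
pose th := `|z| ^+ 2 * `|C z| ^+ 2.
have th0 : 0 <= th by rewrite mulr_ge0// exprn_ge0.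
have V := @coupled_variance R d Omega P _ (sequence_space S) H1 H1 sepH1 sepH1
  (past_seq delta) (coupled_seq delta delta') f b al (zz * al) Ra (zz * Ra) th r
  (fun m => zz * r m) phi mf mb
  mphi mp (measurable_coupled_seq innov)
  (fun k l _ => past_coupled_independent innov (k := k) (l := l)) al0 zal0 r0
    zr0
  (fun n _ => La n) (fun n _ => Lb n) (fun m n _ _ => Lac m n)
  (fun m n _ _ => Lbc m n) (fun m n m0 _ => Lad m n m0) (fun m n m0 _ =>
    Lbd m n m0)
  sr zsr.
set U := al * al * (zz * al * (zz * al)) + _ in V.
have phiE k t : (0 < k)%N -> (\int[P]_w (inner (f (past_seq delta k w)) (f t) *
    inner (b (past_seq delta k w)) (b t))%:E = (phi t)%:E)%E.
  move=> k0; have [i e] := covariance_inner z (f t) k0.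
  apply: Ex_EFin.
    have := rv_integrableZ (inner (f t) z * `|z| ^+ 2) i.
    congr (rv_integrable P _); apply/funext => w.
    by rewrite /b innerZl innerZr inner_norm XE//; ring.
  transitivity (Ex P (fun w => (inner (f t) z * `|z| ^+ 2) *
      (inner (X k w) z * inner (X k w) (f t)))).
    congr (Ex P _); apply/funext => w.
    by rewrite /b innerZl innerZr inner_norm XE//; ring.
  by rewrite ExZ// e /phi (innerC (f t) (C z)); ring.
have thE m n : (0 < m)%N -> (0 < n)%N ->
    (\int[P]_w (phi (coupled_seq delta delta' m n w))%:E = th%:E)%E.
  move=> _ _.
  rewrite (integral_same_law (u2 := past_seq delta 1) (g := EFin \o phi))//;
    last first.
  - exact/measurable_EFinP.
  - by move=> A mA; exact: (coupled_seq_law innov).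
  - exact: (measurable_coupled_seq innov).
  have [i e] := covariance_inner z (C z) (isT : (0 < 1)%N).
  apply: Ex_EFin.
    have := rv_integrableZ (`|z| ^+ 2) i.
    congr (rv_integrable P _); apply/funext => w.
    by rewrite /phi XE//; ring.
  transitivity (Ex P (fun w => `|z| ^+ 2 *
      (inner (X 1%N w) z * inner (X 1%N w) (C z)))).
    congr (Ex P _); apply/funext => w.
    by rewrite /phi XE//; ring.
  by rewrite ExZ// e inner_norm.
have {}V n := V phiE thE th0 n.
have [z0|z0] := eqVneq z 0.
  have C0 : C z = 0.
    apply/eqP; rewrite -normr_eq0 -sqrf_eq0 -inner_norm.
    have [_ <-] := covariance_inner z (C z) (isT : (0 < 1)%N).
    rewrite (_ : (fun w => _) = (fun=> 0)) ?Ex_cst//.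
    by apply/funext => w; rewrite [in X in X * _]z0 inner0r mul0r.
  exists 0 => // n n0; rewrite mul0r.
  have -> : (fun w => `|empirical_tensor X X n w z - C z| ^+ 2) = cst 0.
    apply/funext => w; rewrite C0 subr0 empirical_tensorE big1 ?scaler0 ?normr0
      ?expr0n//.
    by move=> k _; rewrite z0 inner0r scale0r.
  by split; [exact: rv_integrable_cst|rewrite Ex_cst].
exists (`|2 * U| / `|z| ^+ 2); first by rewrite divr_ge0// exprn_ge0.
move=> n n0; have [i e] := V n.
have n0' : 0 < n%:R :> R by rewrite ltr0n.
have nz0 : `|z| != 0 by rewrite normr_eq0.
pose Q w := \sum_(1 <= k < n.+1) \sum_(1 <= l < n.+1)
  inner (f (past_seq delta k w)) (f (past_seq delta l w)) *
  inner (b (past_seq delta k w)) (b (past_seq delta l w)).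
have QE w : `|empirical_tensor X X n w z| ^+ 2 = (`|z| * n%:R) ^- 2 * Q w.
  rewrite -inner_norm inner_empirical_tensor.
  have -> : Q w = `|z| ^+ 2 * (n%:R * \sum_(1 <= k < n.+1)
      inner (X k w) z * inner (X k w) (empirical_tensor X X n w z)).
    rewrite /Q !mulr_sumr; apply: eq_big_nat => k /andP[k0 _].
    rewrite (innerC (X k w) (empirical_tensor _ _ _ _ _))
      inner_empirical_tensor.
    rewrite !mulr_sumr; apply: eq_big_nat => l /andP[l0 _].
    rewrite /b innerZl innerZr inner_norm -!XE// (innerC (X l w) (X k w)).
    by field; rewrite gt_eqF.
  by field; rewrite nz0 gt_eqF.
pose L w := n%:R^-1 * \sum_(1 <= k < n.+1) inner (X k w) z * inner (X k w) (C
  z).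
have [iL eL] : rv_integrable P L /\ Ex P L = `|C z| ^+ 2.
  have [|iS eS] := @rv_integrable_sum _ _ _ P nat (index_iota 1 n.+1)
      (fun k w => inner (X k w) z * inner (X k w) (C z)).
    by move=> k; rewrite mem_index_iota => /andP[k0 _];
      have [] := covariance_inner z (C z) k0.
  split; first exact: rv_integrableZ.
  rewrite ExZ// eS (eq_big_nat _ _ (F2 := fun=> `|C z| ^+ 2)); last first.
    by move=> k /andP[k0 _]; have [_ ->] := covariance_inner z (C z) k0;
      rewrite inner_norm.
  by rewrite sumr_const_nat subn1/= -[X in _ * X = _]mulr_natl mulKf// gt_eqF.
have DE : (fun w => `|empirical_tensor X X n w z - C z| ^+ 2) =
    (fun w => (`|z| * n%:R) ^- 2 * Q w + ((-2) * L w + `|C z| ^+ 2)).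
  apply/funext => w; rewrite sqr_normB QE inner_empirical_tensor /L.
  by rewrite addrA mulNr.
have iQ := rv_integrableZ ((`|z| * n%:R) ^- 2) i.
have iR : rv_integrable P (fun w => (-2) * L w + `|C z| ^+ 2).
  by apply: rv_integrableD; [exact: rv_integrableZ|exact: rv_integrable_cst].
rewrite DE; split; first exact: rv_integrableD.
(* Since [Ex P L = |C z|^2], the last two terms leave [- |C z|^2], which cancels the leading term of
   the bound on [Ex P Q]. *)
have -> : Ex P (fun w => (`|z| * n%:R) ^- 2 * Q w + (-2 * L w + `|C z| ^+ 2)) =
    (`|z| * n%:R) ^- 2 * Ex P Q + (-2 * `|C z| ^+ 2 + `|C z| ^+ 2).
  rewrite (ExD iQ iR) ExZ//.
  rewrite (ExD (rv_integrableZ (-2) iL) (rv_integrable_cst P _)).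
  by rewrite ExZ// eL Ex_cst.
have : (`|z| * n%:R) ^- 2 * Ex P Q <= (`|z| * n%:R) ^- 2 * (n%:R ^+ 2 * th +
  n%:R * (2 * U)).
  by rewrite ler_wpM2l// invr_ge0 exprn_ge0// mulr_ge0.
have -> : (`|z| * n%:R) ^- 2 * (n%:R ^+ 2 * th + n%:R * (2 * U)) =
    `|C z| ^+ 2 + 2 * U / `|z| ^+ 2 / n%:R.
  by rewrite /th; field; rewrite nz0 gt_eqF.
have : 2 * U / `|z| ^+ 2 / n%:R <= `|2 * U| / `|z| ^+ 2 / n%:R.
  by rewrite !ler_wpM2r ?invr_ge0 ?exprn_ge0// ler_norm.
lra.
Qed.

End covariance_operator.

End consistency_bounds.

(** * Events of large probability *)

Section likely_events.
Context (R : realType) d (Omega : measurableType d) (P : probability Omega R).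

(* The inner measurable event is there because [P] is arbitrary on
   non-measurable sets. *)
Definition likely (eta : R) (A : nat -> set Omega) : Prop :=
  \forall n \near \oo, exists2 B, measurable B &
    B `<=` A n /\ (P (~` B) <= eta%:E)%E.

Lemma likelyI a b A B : likely a A -> likely b B ->
  likely (a + b) (fun n => A n `&` B n).
Proof.
move=> hA hB; near=> n.
have [A' mA' [sA pA]] : exists2 A', measurable A' & A' `<=` A n /\ (P (~` A')
  <= a%:E)%E.
  by near: n.
have [B' mB' [sB pB]] : exists2 B', measurable B' & B' `<=` B n /\ (P (~` B')
  <= b%:E)%E.
  by near: n.
exists (A' `&` B'); first exact: measurableI.
split; first exact: setISS.
rewrite setCI (le_trans (measureU2 _ (measurableC mA') (measurableC mB')))//.
by rewrite EFinD leeD.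
Unshelve. all: by end_near. Qed.

Lemma likely_sub a A B : (\forall n \near \oo, A n `<=` B n) ->
  likely a A -> likely a B.
Proof.
move=> AB hA; near=> n.
have [A' mA' [sA pA]] : exists2 A', measurable A' & A' `<=` A n /\ (P (~` A')
  <= a%:E)%E.
  by near: n.
exists A' => //; split => //; apply: subset_trans sA _.
by near: n.
Unshelve. all: by end_near. Qed.

Lemma likely_markov (Z : nat -> Omega -> R) (c : nat -> R) eta :
  (forall n w, (0 < n)%N -> 0 <= Z n w) ->
  (forall n, (0 < n)%N -> rv_integrable P (Z n)) ->
  (\forall n \near \oo, 0 < c n /\ Ex P (Z n) <= eta * c n) ->
  likely eta (fun n => [set w | Z n w < c n]).
Proof.
move=> Z0 Zi hc; near=> n.
have n0 : (0 < n)%N by near: n; exact: nbhs_infty_gt.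
have [c0 Ec] : 0 < c n /\ Ex P (Z n) <= eta * c n by near: n.
have mZ := rv_integrable_measurable (Zi n n0).
exists [set w | Z n w < c n]; first exact: measurable_lt.
split => //.
have -> : ~` [set w | Z n w < c n] = [set w | c n <= Z n w].
  by apply/seteqP; split => w /=; rewrite leNgt => /negP.
apply: le_trans (markov_ineq c0 (Zi n n0) (fun w => Z0 n w n0)) _.
by rewrite lee_fin ler_pdivrMr.
Unshelve. all: by end_near. Qed.

Lemma likely_forall (A : nat -> nat -> set Omega) (N : nat) eta :
  (forall i e, 0 < e -> likely e (A i)) -> 0 < eta ->
  likely eta (fun n => [set w | forall i, (i < N)%N -> A i n w]).
Proof.
move=> hA; elim: N eta => [|N IH] eta eta0.
  apply/nearW => n; exists setT => //; split => //.
  by rewrite setCT measure0 lee_fin ltW.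
have e2 : 0 < eta / 2 by rewrite divr_gt0.
have := likelyI (IH _ e2) (hA N _ e2); rewrite -splitr.
apply: likely_sub; apply/nearW => n w /= [h1 h2] i.
by rewrite ltnS leq_eqVlt => /predU1P[->|/h1].
Qed.

Lemma likely_cvg0 (D : nat -> Omega -> R) (e : R) :
  (\forall n \near \oo, measurable [set w | e < D n w]) ->
  (forall eta, 0 < eta -> likely eta (fun n => [set w | D n w <= e])) ->
  P [set w | e < D n w] @[n --> \oo] --> 0%E.
Proof.
move=> mD hD; apply/fine_cvgP; split.
  by near=> n; apply: fin_num_measure; near: n.
apply/cvgrPdist_le => /= eta eta0; near=> n.
have mDn : measurable [set w | e < D n w] by near: n.
have [B mB [sB pB]] : exists2 B, measurable B &
    B `<=` [set w | D n w <= e] /\ (P (~` B) <= eta%:E)%E.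
  by near: n; exact: hD.
rewrite sub0r normrN ger0_norm ?fine_ge0//.
rewrite -lee_fin fineK ?fin_num_measure//; apply: le_trans pB.
(* Measurability of the error event is indispensable here: monotonicity of [P] compares measurable
   sets only. *)
apply: le_measure; rewrite ?inE//; first exact: measurableC.
by move=> w /= eD /sB/=; rewrite leNgt eD.
Unshelve. all: by end_near. Qed.

End likely_events.

Section net.
Context (R : realType) d (Omega : measurableType d) (P : probability Omega R).
Context d' (T : measurableType d') (H : hilbertType R).
Variables (p : nat -> Omega -> T) (f : T -> H) (u : nat -> H).
Hypothesis sepH : separable H.
Hypothesis mp : forall n, measurable_fun setT (p n).
Hypothesis law : forall n A, measurable A -> P (p n @^-1` A) = P (p 1%N @^-1`
  A).
Hypothesis mf : weakly_measurable f.
Hypothesis u_dense : forall x e, 0 < e -> exists k, `|x - u k| < e.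

(** The sets [far N] decrease to the empty set because [u] is dense, so continuity from above makes
    one of them small at time 1; equality of laws makes that [N] valid at every time. *)
Lemma likely_net rho eta : 0 < rho -> 0 < eta ->
  exists N, likely P eta
    (fun n => [set w | exists2 i, (i < N)%N & `|f (p n w) - u i| < rho]).
Proof.
move=> rho0 eta0.
pose far N : set T := [set t | forall i, (i < N)%N -> rho <= `|f t - u i|].
have mfar N : measurable (far N).
  have -> : far N = \bigcap_(i in [set i | (i < N)%N]) [set t | rho <= `|f t -
    u i|].
    by apply/seteqP; split.
  apply: bigcap_measurableType => i _; apply: measurable_le => //.
  by apply: measurable_fun_normr => //; apply: weakly_measurableB => //;
    exact: weakly_measurable_cst.
have mpre n N : measurable (p n @^-1` far N).
  by rewrite -[X in measurable X]setTI; exact: mp.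
have cap0 : \bigcap_N (p 1%N @^-1` far N) = set0.
  apply/seteqP; split => w //= hw.
  have [k hk] := u_dense (f (p 1%N w)) rho0.
  by have := hw k.+1 I k (ltnSn k); rewrite leNgt hk.
have : P \o (fun N => p 1%N @^-1` far N) @ \oo --> P (\bigcap_N (p 1%N @^-1`
  far N)).
  apply: nonincreasing_cvg_mu => //.
  - by rewrite (le_lt_trans (probability_le1 _ _))// ltry.
  - by rewrite cap0.
  - move=> N M NM; apply/subsetPset => w hw i iN; apply: hw.
    exact: leq_trans NM.
rewrite cap0 measure0 =>
  /fine_cvgP[_ /cvgrPdist_le/(_ _ eta0)[N _ /(_ N (leqnn N))]] /=.
rewrite sub0r normrN ger0_norm ?fine_ge0// => hN.
exists N; apply/nearW => n; exists (~` (p n @^-1` far N));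
  first exact: measurableC.
split.
  move=> w /= hw; apply: contrapT => nex; apply: hw => i iN.
  by rewrite leNgt; apply/negP => hi; apply: nex; exists i.
rewrite setCK law//.
by rewrite -(fineK (fin_num_measure P _ (mpre 1%N N))) lee_fin.
Qed.

End net.

(** * Nondegeneracy of the covariance and convergence of the prediction error *)

Lemma bounded_operator_continuous (R : realType) (H1 H2 : hilbertType R)
    (Psi : {linear H1 -> H2}) (M : R) :
  (forall y, `|Psi y| <= M * `|y|) -> continuous Psi.
Proof.
move=> PsiM x; apply/cvgrPdist_lt => /= e e0.
have M1 : 0 < `|M| + 1 by rewrite ltr_wpDl.
near=> y; rewrite -linearB (le_lt_trans (PsiM _))//.
rewrite (@le_lt_trans _ _ ((`|M| + 1) * `|x - y|))//.
  by rewrite ler_wpM2r// (le_trans (ler_norm _))// lerDl.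
rewrite mulrC -ltr_pdivlMr//; near: y; apply: cvgr_dist_lt; first by [].
by rewrite divr_gt0.
Unshelve. all: by end_near. Qed.

(** This provides the lower bound on the top empirical eigenvalue. If the quadratic form of [C]
    vanished, polarization would give [C = 0], and the range of [C] could not be dense in a nonzero
    space; the case [n = 0] of infinite dimension supplies a nonzero vector. *)
Lemma covariance_nondegenerate (R : realType) (H : hilbertType R) d
    (Omega : measurableType d) (P : probability Omega R) (X : Omega -> H)
    (C : H -> H) :
  infinite_dimensional H ->
  (forall z h, rv_integrable P (fun w => inner (X w) z * inner (X w) h) /\
     Ex P (fun w => inner (X w) z * inner (X w) h) = inner (C z) h) ->
  closure (range C) = [set: H] ->
  exists2 z, z != 0 & 0 < inner (C z) z.
Proof.
move=> infH Cin Cdense; apply: contrapT => nz.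
have Czz z : inner (C z) z = 0.
  apply/eqP; rewrite eq_le; apply/andP; split; last first.
    have [i <-] := Cin z z; rewrite -(Ex_cst P 0); apply: le_Ex => //.
      exact: rv_integrable_cst.
    by move=> w; rewrite -expr2 sqr_ge0.
  rewrite leNgt; apply/negP => Cz; apply: nz; exists z => //.
  by apply: contraTN Cz => /eqP ->; rewrite inner0r ltxx.
have C0 z : C z = 0.
  apply: eq_innerl => h; rewrite inner0l.
  have [i1 e1] := Cin z z; have [i2 e2] := Cin z h; have [i3 e3] := Cin h h.
  have [_ e4] := Cin (z + h) (z + h); move: e4.
  have -> : (fun w => inner (X w) (z + h) * inner (X w) (z + h)) =
      (fun w => inner (X w) z * inner (X w) z + (2 * (inner (X w) z * inner (X
        w) h)
         + inner (X w) h * inner (X w) h)).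
    by apply/funext => w; rewrite innerDr; ring.
  have i23 := rv_integrableD (rv_integrableZ 2 i2) i3.
  rewrite (ExD i1 i23) (ExD (rv_integrableZ 2 i2) i3) ExZ// e1 e2 e3 !Czz; lra.
have [x /(_ (fun=> 0)) x0] := infH 0%N (fun=> 0).
rewrite big_ord0 in x0.
have nx : 0 < `|x| by rewrite normr_gt0; apply/eqP.
have : closure (range C) x by rewrite Cdense.
move=> /(_ (ball x `|x|) (nbhsx_ballx _ _ nx))[_ [[z _ <-]]].
by rewrite -ball_normE/= C0 subr0 ltxx.
Qed.

Theorem theorem2 (R : realType) (H1 H2 : hilbertType R)
  (d : measure_display) (Omega : measurableType d) (P : probability Omega R)
  (Psi : {linear H1 -> H2}) (X : nat -> Omega -> H1)
  (eps Y : nat -> Omega -> H2) (C : H1 -> H1) (m : nat -> R)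
  (lam : nat -> Omega -> nat -> R) (v : nat -> Omega -> nat -> H1) :
  separable H1 -> separable H2 -> infinite_dimensional H1 ->
  assumption_A P Psi X eps ->
  (forall k w, (0 < k)%N -> Y k w = Psi (X k w) + eps k w) ->
  is_operator_expectation P (fun w => tensor (X 1%N w) (X 1%N w)) C ->
  closure (range C) = [set: H1] ->
  m n @[n --> \oo] --> +oo ->
  m =o_\oo (fun n : nat => Num.sqrt n%:R) ->
  (forall n w, eigensystem (empirical_tensor X X n w) (lam n w) (v n w)) ->
  cvg_in_probability P
    (fun n w =>
       `| Psi (X n w)
          - truncated_estimator (empirical_tensor X Y n w) (lam n w) (v n w)
              (truncation_level (lam n w) (m n)) (X n w) |)
    (fun=> 0).
Proof.
move=> sepH1 sepH2 infH1 [[M0 PsiM0] _ _ approx _ Xe] YE CE Cdense mcvg mo eig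
  e e0.
case: approx => d' [S [delta [delta' [f [g [innov aX ae]]]]]].
pose M := `|M0| + 1.
have M_gt0 : 0 < M by rewrite ltr_wpDl.
have PsiM y : `|Psi y| <= M * `|y|.
  by rewrite (le_trans (PsiM0 y))// ler_wpM2r// (le_trans (ler_norm _))// lerDl.
have mX k (k0 : (0 < k)%N) := weakly_measurable_X innov aX k0.
have mPsiX k : (0 < k)%N -> weakly_measurable (Psi \o X k).
  move=> k0; apply: borel_weakly_measurable.
  apply: measurable_fun_borel; first exact: (bounded_operator_continuous PsiM).
  have [mf XE _ _] := aX; have -> : X k = f \o past_seq delta k.
    by apply/funext => w; exact: XE.
  exact: (measurableT_comp mf (measurable_past_seq innov k)).
have mY k : (0 < k)%N -> weakly_measurable (Y k).
  move=> k0; have -> : Y k = (fun w => (Psi \o X k) w + eps k w).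
    by apply/funext => w; exact: YE.
  by apply: weakly_measurableD;
    [exact: mPsiX|exact: (weakly_measurable_X innov ae)].
have mge A : \forall n \near \oo, A <= m n by move/cvgryPge : mcvg; exact.
have [M2 M20 X2] := X_second_moment sepH1 innov aX.
have [M6 M60 W6] := noise_bound sepH1 sepH2 innov aX ae Xe.
have Cin z h := covariance_inner sepH1 innov aX CE z h (isT : (0 < 1)%N).
have [u u_dense] := separable_enumeration sepH1.
have [zs zs0 kappa0] := covariance_nondegenerate infH1 Cin Cdense.
set kappa := inner (C zs) zs in kappa0.
have nzs : 0 < `|zs| by rewrite normr_gt0.
apply: likely_cvg0 => [|eta eta0].
  near=> n.
  have n0 : (0 < n)%N by near: n; exact: nbhs_infty_gt.
  have mn1 : 1 <= m n by near: n; exact: mge.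
  apply: measurable_lt => //; under eq_fun do rewrite subr0 normr_id.
  apply: measurable_fun_normr => //; apply: weakly_measurableB.
    exact: (mPsiX n n0).
  exact: (weakly_measurable_truncated_estimator sepH1 mX mY (eig n) mn1 (mX n
    n0)).
(* Six events are intersected, each failing with probability at most [s]. With the choice of [rho],
   a bias of four terms of size [rho], multiplied by [M], is [e / 2]. Through Markov's inequality
   [B] bounds both [|X_n|^2] and the average of the [|X_k|^2], hence also [lam 0]. *)
pose s := eta / 6; have s0 : 0 < s by rewrite divr_gt0.
pose rho := e / (8 * M); have rho0 : 0 < rho by rewrite divr_gt0// mulr_gt0.
pose B := (M2 + 1) / s; have B0 : 0 < B by rewrite divr_gt0// ltr_wpDl.
have sB : M2 <= s * B by rewrite mulrC divfK ?gt_eqF// lerDl.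
pose L := Num.sqrt B; have L0 : 0 < L by rewrite sqrtr_gt0.
have near_n A : \forall n \near \oo, A <= (n%:R : R).
  by have /cvgryPge := @cvgr_idn R; exact.
have covz z r eta' : 0 < r -> 0 < eta' -> likely P eta' (fun n =>
    [set w | `|empirical_tensor X X n w z - C z| ^+ 2 < r ^+ 2]).
  move=> r0 eta'0.
  have [Mz Mz0 hz] := empirical_covariance_bound sepH1 innov aX CE z.
  apply: likely_markov => [n w _|n n0|].
  - exact: sqr_ge0.
  - by have [] := hz n n0.
  near=> n; have n0 : (0 < n)%N by near: n; exact: nbhs_infty_gt.
  split; first exact: exprn_gt0.
  have [_ h] := hz n n0; rewrite (le_trans h)// ler_pdivrMr ?ltr0n//.
  rewrite mulrC -ler_pdivrMr ?mulr_gt0 ?exprn_gt0//.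
  by near: n; exact: near_n.
have ev1 : likely P s (fun n => [set w | `|X n w| ^+ 2 < B]).
  apply: likely_markov => [n w _|n n0|].
  - exact: sqr_ge0.
  - by have [] := X2 n n0.
  near=> n; have n0 : (0 < n)%N by near: n; exact: nbhs_infty_gt.
  by split => //; have [_ h] := X2 n n0; exact: le_trans sB.
have [N ev2] : exists N, likely P s
    (fun n => [set w | exists2 i, (i < N)%N & `|X n w - u i| < rho]).
  have [N hN] := likely_net sepH1 (measurable_past_seq innov)
    (fun n A => @past_seq_law _ _ _ _ _ _ _ _ innov 1 n A)
    (weakly_measurable_representation aX) u_dense rho0 s0.
  exists N; apply: likely_sub hN; near=> n => w.
  have n0 : (0 < n)%N by near: n; exact: nbhs_infty_gt.
  by rewrite /= (representationE aX w n0).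
have /choice[z hz] : forall i, exists z, `|u i - C z| < rho.
  move=> i; have : closure (range C) (u i) by rewrite Cdense.
  move=> /(_ (ball (u i) rho) (nbhsx_ballx _ _ rho0))[_ [[z _ <-]]].
  by rewrite -ball_normE/=; exists z.
have ev3 := likely_forall N (fun i e' e'0 => covz (z i) rho e' rho0 e'0) s0.
have ev4 : likely P s (fun n => [set w |
    n%:R^-1 * \sum_(1 <= k < n.+1) `|X k w| ^+ 2 < B]).
  have sumX n : (0 < n)%N -> rv_integrable P (fun w => n%:R^-1 *
        \sum_(1 <= k < n.+1) `|X k w| ^+ 2) /\
      Ex P (fun w => n%:R^-1 * \sum_(1 <= k < n.+1) `|X k w| ^+ 2) <= M2.
    move=> n0; have [|i h] := @rv_integrable_sum _ _ _ P nat (index_iota 1 n.+1)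
      (fun k w => `|X k w| ^+ 2).
      by move=> k; rewrite mem_index_iota => /andP[k0 _]; have [] := X2 k k0.
    split; first exact: rv_integrableZ.
    rewrite ExZ// h mulrC ler_pdivrMr ?ltr0n//.
    rewrite (@le_trans _ _ (\sum_(1 <= k < n.+1) M2))//.
      by rewrite !big_nat; apply: ler_sum => k /andP[k0 _]; have [] := X2 k k0.
    by rewrite sumr_const_nat subn1/= mulr_natr.
  apply: likely_markov => [n w _|n n0|].
  - by rewrite mulr_ge0 ?invr_ge0// sumr_ge0// => k _; exact: sqr_ge0.
  - by have [] := sumX n n0.
  near=> n; have n0 : (0 < n)%N by near: n; exact: nbhs_infty_gt.
  by split => //; have [_ h] := sumX n n0; exact: le_trans sB.
(* At this accuracy the quadratic form of [Chat] at [zs] is at least [kappa / 2], so that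
   [lam 0 >= ell]. *)
have k5 : 0 < kappa / (2 * `|zs|) by rewrite divr_gt0// mulr_gt0.
have ev5 := covz zs _ s k5 s0.
pose ell := kappa / (2 * `|zs| ^+ 2).
have ell0 : 0 < ell by rewrite divr_gt0// mulr_gt0// exprn_gt0.
(* Chosen so that [(m n / ell) * L * (c6 / m n) = e / 2]. *)
pose c6 := e * ell / (2 * L).
have c60 : 0 < c6 by rewrite divr_gt0// mulr_gt0.
have ev6 : likely P s (fun n => [set w | n%:R ^- 2 *
    \sum_(1 <= k < n.+1) \sum_(1 <= l < n.+1)
    inner (X k w) (X l w) * inner (eps k w) (eps l w) < (c6 / m n) ^+ 2]).
  apply: likely_markov => [n w n0|n n0|].
  - rewrite -(sum_sqr_norm_Ehat eps (eig n w)); apply: sumr_ge0 => j _.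
    exact: sqr_ge0.
  - by have [] := W6 n n0.
  (* The rate [m n <= t * sqrt n] is what makes [M6 / n <= s * (c6 / m n)^2], as Markov's inequality
     requires. *)
  pose t := c6 * Num.sqrt (s / (M6 + 1)).
  have M61 : 0 < M6 + 1 by rewrite ltr_wpDl.
  have t0 : 0 < t by rewrite mulr_gt0// sqrtr_gt0 divr_gt0.
  have /eqoP/(_ t t0) mt := mo.
  near=> n; have n0 : (0 < n)%N by near: n; exact: nbhs_infty_gt.
  have n0' : 0 < n%:R :> R by rewrite ltr0n.
  have mn1 : 1 <= m n by near: n; exact: mge.
  have mn0 : 0 < m n by exact: lt_le_trans mn1.
  split; first by rewrite exprn_gt0// divr_gt0.
  have [_ h] := W6 n n0; rewrite (le_trans h)// ler_pdivrMr//.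
  have mt' : `|m n| <= t * `|Num.sqrt (n%:R : R)| by near: n.
  rewrite (gtr0_norm mn0) ger0_norm ?sqrtr_ge0// in mt'.
  have m2 : m n ^+ 2 <= c6 ^+ 2 * (s / (M6 + 1)) * n%:R.
    have <- : (t * Num.sqrt n%:R) ^+ 2 = c6 ^+ 2 * (s / (M6 + 1)) * n%:R.
      rewrite /t !exprMn !sqr_sqrtr// ?ltW//; exact: divr_gt0.
    by rewrite lerXn2r ?nnegrE// ?ltW// mulr_gt0// sqrtr_gt0.
  have -> : s * (c6 / m n) ^+ 2 * n%:R = (s * c6 ^+ 2 * n%:R) / m n ^+ 2.
    by field; rewrite gt_eqF.
  rewrite ler_pdivlMr ?exprn_gt0//.
  apply: (le_trans (ler_wpM2l M60 m2)).
  have -> : M6 * (c6 ^+ 2 * (s / (M6 + 1)) * n%:R) =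
      (s * c6 ^+ 2 * n%:R) * (M6 / (M6 + 1)).
    by field; rewrite gt_eqF.
  apply: ler_piMr.
    by apply: mulr_ge0 => //; apply: mulr_ge0; [exact: ltW|exact: sqr_ge0].
  by rewrite ler_pdivrMr// mul1r lerDl.
have := likelyI (likelyI (likelyI ev1 ev2) (likelyI ev3 ev4)) (likelyI ev5 ev6).
have -> : s + s + (s + s) + (s + s) = eta by rewrite /s; field.
apply: likely_sub.
(* The net index [i] depends on [w]. The sum bounds every [|z i|] at once, so that [n] can be taken
   large, with [B * Z / rho <= m n], before [w] is fixed. *)
pose Z := \sum_(i < N) `|z i|.
near=> n => w [] [] [] h1 [i iN h2] [h3 h4] [h5 h6] /=.
have n0 : (0 < n)%N by near: n; exact: nbhs_infty_gt.
have mn1 : 1 <= m n by near: n; exact: mge.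
have mn0 : 0 < m n by exact: lt_le_trans mn1.
have mZ : B * Z / rho <= m n by near: n; exact: mge.
rewrite subr0 normr_id.
have E k (k0 : (0 < k)%N) := YE k w k0.
apply: (le_trans (@prediction_error_le _ _ _ _ Psi X eps Y n w _ _ (m n) (eig n
  w)
  E M C (X n w) (u i) (z i) mn0 (ltW M_gt0) PsiM)).
have lam0 : 0 <= lam n w 0 by case: (eig n w).
have lamB : lam n w 0 <= B.
  exact: (le_trans (top_eigenvalue_le_trace (eig n w)) (ltW h4)).
have ell_lam : ell <= lam n w 0.
  have hr := rayleigh_le (eig n w) zs.
  have hc := inner_le (C zs - empirical_tensor X X n w zs) zs.
  rewrite innerBl -/kappa distrC in hc.
  have h5' : `|empirical_tensor X X n w zs - C zs| <= kappa / (2 * `|zs|).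
    by rewrite -(@ler_pXn2r _ 2)// ?nnegrE// ltW.
  have hk : `|empirical_tensor X X n w zs - C zs| * `|zs| <= kappa / 2.
    apply: (le_trans (ler_wpM2r (ltW nzs) h5')).
    by rewrite le_eqVlt; apply/orP; left; apply/eqP; field; rewrite gt_eqF.
  rewrite /ell ler_pdivrMr ?mulr_gt0 ?exprn_gt0//.
  lra.
have lam_gt0 : 0 < lam n w 0 by exact: lt_le_trans ell_lam.
have part2 : m n / lam n w 0 * `|X n w| * Num.sqrt (n%:R ^- 2 *
    \sum_(1 <= k < n.+1) \sum_(1 <= l < n.+1)
    inner (X k w) (X l w) * inner (eps k w) (eps l w)) <= e / 2.
  have XL : `|X n w| <= L.
    rewrite -[leLHS]ger0_norm// -sqrtr_sqr /L; apply: ler_wsqrtr.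
    exact: ltW h1.
  have WL : Num.sqrt (n%:R ^- 2 *
      \sum_(1 <= k < n.+1) \sum_(1 <= l < n.+1)
      inner (X k w) (X l w) * inner (eps k w) (eps l w)) <= c6 / m n.
    have cm0 : 0 < c6 / m n by rewrite divr_gt0.
    rewrite -[leRHS](gtr0_norm cm0) -sqrtr_sqr; apply: ler_wsqrtr.
    exact: ltW h6.
  apply: (@le_trans _ _ (m n / ell * L * (c6 / m n))).
    have mlam0 : 0 < m n / lam n w 0 by rewrite divr_gt0.
    apply: ler_pM => //; first by rewrite mulr_ge0// ltW.
    apply: ler_pM => //; first exact: ltW.
    by apply: ler_wpM2l; [exact: ltW|rewrite lef_pV2 ?posrE].
  rewrite le_eqVlt; apply/orP; left; apply/eqP; rewrite /c6; field.
  by rewrite !gt_eqF.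
have part1 : `|X n w - u i| + `|u i - C (z i)| +
    `|empirical_tensor X X n w (z i) - C (z i)| + lam n w 0 / m n * `|z i| <=
    4 * rho.
  have h3' : `|empirical_tensor X X n w (z i) - C (z i)| <= rho.
    rewrite -(@ler_pXn2r _ 2)// ?nnegrE ?(ltW rho0)//.
    exact/ltW/h3.
  have zZ : `|z i| <= Z.
    rewrite /Z (bigD1 (Ordinal iN))//= lerDl sumr_ge0//.
  have h4' : lam n w 0 / m n * `|z i| <= rho.
    rewrite mulrAC ler_pdivrMr// mulrC.
    rewrite ler_pdivrMr// in mZ; rewrite (le_trans _ (le_trans mZ _))//.
      by rewrite mulrC ler_pM.
    by rewrite mulrC.
  have h2' := ltW h2; have hz' := ltW (hz i).
  lra.
have : M * (4 * rho) = e / 2 by rewrite /rho; field; rewrite gt_eqF.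
have := ler_wpM2l (ltW M_gt0) part1.
lra.
Unshelve. all: by end_near. Qed.
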